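(* Consider the six-dimensional real Lie algebras $$ \begin{aligned} \mathfrak g_1 &= (e^{15},-e^{25},-e^{35},e^{45},0,0),\\ \mathfrak g_2^{\alpha} &= (\alpha e^{15}+e^{25},\,-e^{15}+\alpha e^{25},\,-\alpha e^{35}+e^{45},\,-e^{35}-\alpha e^{45},\,0,\,0),\quad \alpha\ge 0,\\ \mathfrak g_3 &= (0,-e^{13},e^{12},0,-e^{46},-e^{45}),\\ \mathfrak g_4 &= (e^{23},-e^{36},e^{26},-e^{56},e^{46},0),\\ \mathfrak g_5 &= (e^{24}+e^{35},e^{26},e^{36},-e^{46},-e^{56},0),\\ \mathfrak g_6 &= (e^{24}+e^{35},-e^{36},e^{26},-e^{56},e^{46},0),\\ \mathfrak g_7 &= (e^{24}+e^{35},e^{46},e^{56},-e^{26},-e^{36},0),\\ \mathfrak g_8 &= (e^{16}-e^{25},e^{15}+e^{26},-e^{36}+e^{45},-e^{35}-e^{46},0,0),\\ \mathfrak g_9 &= (e^{45},e^{15}+e^{36},e^{14}-e^{26}+e^{56},-e^{56},e^{46},0). \end{aligned} $$ For any $k\in\{1,3,4,5,6,7,8,9\}$, the connected and simply-connected Lie group $G_k$ with Lie algebra $\mathfrak g_k$ admits a lattice. Moreover, there exists a countably infinite set of values $\alpha\ge 0$, including $\alpha=0$, for which the connected and simply-connected Lie group with Lie algebra $\mathfrak g_2^{\alpha}$ admits a lattice.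
   Context: The notation $\mathfrak g=(\epsilon_1,\dots,\epsilon_6)$ means that $\mathfrak g$ is the real Lie algebra whose dual has a basis $\{e^1,\dots,e^6\}$ with $de^i=\epsilon_i$, where $d$ is the Chevalley–Eilenberg differential ($d\alpha(X,Y)=-\alpha([X,Y])$) and $e^{ij}=e^i\wedge e^j$. A lattice in a Lie group $G$ is a discrete subgroup $\Gamma$ with $\Gamma\backslash G$ compact. *)

(* Defs.v *)
From HB Require Import structures.
From mathcomp Require Import all_boot all_order all_algebra generic_quotient.
From mathcomp Require Import all_classical all_reals all_analysis.

Set Implicit Arguments.
Unset Strict Implicit.
Unset Printing Implicit Defensive.

Import Order.TTheory GRing.Theory Num.Theory numFieldNormedType.Exports.

Local Open Scope classical_set_scope.
Local Open Scope ring_scope.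

(* [U] is meant to be open, [V] and [W] finite-dimensional; the values of [f]  *)
(* outside [U] play no role.                                                   *)
Fixpoint Ck_on (R : realType) (V W : normedModType R) (k : nat) (U : set V)
    (f : V -> W) : Prop :=
  if k is k'.+1 then
    (forall x, U x -> differentiable f x) /\ (forall v, Ck_on k' U ('D_v f))
  else forall x, U x -> {for x, continuous f}.

Definition smooth_on (R : realType) (V W : normedModType R) (U : set V)
    (f : V -> W) : Prop :=
  forall k, Ck_on k U f.

Record chart (R : realType) (n : nat) (M : topologicalType) := Chart {
  chart_dom : set M;
  chart_cod : set 'rV[R]_n;
  chart_map : M -> 'rV[R]_n;
  chart_inv : 'rV[R]_n -> M;
  chart_dom_open : open chart_dom;
  chart_cod_open : open chart_cod;
  chart_map_fun : forall x, chart_dom x -> chart_cod (chart_map x);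
  chart_inv_fun : forall y, chart_cod y -> chart_dom (chart_inv y);
  chart_mapK : forall x, chart_dom x -> chart_inv (chart_map x) = x;
  chart_invK : forall y, chart_cod y -> chart_map (chart_inv y) = y;
  chart_map_continuous : {within chart_dom, continuous chart_map};
  chart_inv_continuous : {within chart_cod, continuous chart_inv}
}.

HB.mixin Record Topological_isManifold (R : realType) (n : nat) (M : Type)
    of Topological M := {
  atlas : set (chart R n M);
  atlas_cover : forall x : M, exists2 c, atlas c & chart_dom c x;
  atlas_compatible : forall c d, atlas c -> atlas d ->
    smooth_on (chart_cod c `&` chart_inv c @^-1` chart_dom d)
      (chart_map d \o chart_inv c);
  manifold_hausdorff : hausdorff_space M;
  manifold_second_countable : @second_countable M
}.

#[short(type="manifoldType")]
HB.structure Definition Manifold (R : realType) (n : nat) :=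
  {M of Topological_isManifold R n M & Topological M}.

Arguments atlas {R n} s : rename.

HB.mixin Record Manifold_isLieGroup (R : realType) (n : nat) (G : Type)
    of Manifold R n G & Group G := {
  lie_mul_continuous : continuous (fun p : G * G => (p.1 * p.2)%g);
  lie_inv_continuous : continuous (fun x : G => (x^-1)%g);
  lie_mul_smooth : forall b c d : chart R n G,
    atlas G b -> atlas G c -> atlas G d ->
    smooth_on [set p | [/\ chart_cod b p.1, chart_cod c p.2 &
                        chart_dom d (chart_inv b p.1 * chart_inv c p.2)%g]]
      (fun p : 'rV[R]_n * 'rV[R]_n =>
         chart_map d (chart_inv b p.1 * chart_inv c p.2)%g);
  lie_inv_smooth : forall c d : chart R n G, atlas G c -> atlas G d ->
    smooth_on [set y | chart_cod c y /\ chart_dom d (chart_inv c y)^-1%g]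
      (fun y : 'rV[R]_n => chart_map d (chart_inv c y)^-1%g)
}.

#[short(type="lieGroupType")]
HB.structure Definition LieGroup (R : realType) (n : nat) :=
  {G of Manifold_isLieGroup R n G & Manifold R n G & Group G}.

Section VectorFields.
Context {R : realType} {n : nat} (M : manifoldType R n).
Implicit Types (f : M -> R) (X Y : (M -> R) -> M -> R).

Definition smooth_fun f : Prop :=
  forall c, atlas M c -> smooth_on (chart_cod c) (f \o chart_inv c).

(* A tangent vector at [x] is identified with the derivation                   *)
(* f |-> sum_i v_i (d/dx_i) f at [x] of the algebra of smooth functions.       *)
Definition tangent_vector (x : M) (D : (M -> R) -> R) : Prop :=
  exists c v, [/\ atlas M c, chart_dom c x & forall f, smooth_fun f ->
    D f = 'D_v (f \o chart_inv c) (chart_map c x)].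

(* Vector fields act on smooth functions; the values of [X] on other functions *)
(* are irrelevant, hence the relation [eq_field] in place of equality.         *)
Definition vector_field X : Prop :=
  (forall x, tangent_vector x (fun f => X f x)) /\
  (forall f, smooth_fun f -> smooth_fun (X f)).

Definition eq_field X Y : Prop := forall f, smooth_fun f -> X f =1 Y f.

Definition field_bracket X Y : (M -> R) -> M -> R :=
  fun f x => X (Y f) x - Y (X f) x.

End VectorFields.

Definition left_invariant (R : realType) (n : nat) (G : lieGroupType R n)
    (X : (G -> R) -> G -> R) : Prop :=
  vector_field X /\
  forall (a : G) (f : G -> R), smooth_fun f ->
    X (fun x => f (a * x)%g) =1 (fun x => X f (a * x)%g).

(* A 2-form on R^n is encoded by its antisymmetric matrix [w], with            *)
(* w(x, y) = x w y^T.                                                          *)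
Definition eval_form (R : realType) (n : nat) (w : 'M[R]_n) (x y : 'rV[R]_n)
    : R :=
  (x *m w *m y^T) 0 0.

(* The Lie bracket on R^n determined by de^k = eps_k for the basis (e^k) dual  *)
(* to the standard one: e^k([x, y]) = - de^k(x, y).                            *)
Definition ce_bracket (R : realType) (n : nat) (eps : n.-tuple 'M[R]_n)
    (x y : 'rV[R]_n) : 'rV[R]_n :=
  \row_k (- eval_form (tnth eps k) x y).

(* The left-invariant vector fields on [G] form a Lie algebra isomorphic,      *)
(* through [phi], to R^n with the bracket [ce_bracket eps].                    *)
Definition has_lie_algebra (R : realType) (n : nat) (G : lieGroupType R n)
    (eps : n.-tuple 'M[R]_n) : Prop :=
  exists phi : 'rV[R]_n -> (G -> R) -> G -> R,
  [/\ forall u, left_invariant (phi u),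
      forall a u v,
        eq_field (phi (a *: u + v)) (fun f x => a * phi u f x + phi v f x),
      forall Y, left_invariant Y -> exists! u, eq_field Y (phi u) &
      forall u v,
        eq_field (phi (ce_bracket eps u v)) (field_bracket (phi u) (phi v))].

Definition simply_connected (R : realType) (T : topologicalType) : Prop :=
  connected [set: T] /\
  forall gamma : R -> T, {within `[0, 1], continuous gamma} ->
    gamma 0 = gamma 1 ->
    exists H : R * R -> T,
      [/\ {within `[0, 1] `*` `[0, 1], continuous H},
          forall t, t \in `[0, 1] -> H (0, t) = gamma t,
          forall t, t \in `[0, 1] -> H (1, t) = gamma 0 &
          forall s, s \in `[0, 1] -> H (s, 0) = gamma 0 /\ H (s, 1) = gamma 0].

Section Cosets.
Context {G : groupType} (Gamma : groupClosed G).

(* Gamma x = Gamma y *)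
Definition same_coset (x y : G) : bool := (x * y^-1)%g \in Gamma.

Fact same_coset_refl : reflexive same_coset.
Proof. by move=> x; rewrite /same_coset mulgV gpred1. Qed.

Fact same_coset_sym : symmetric same_coset.
Proof. by move=> x y; rewrite /same_coset -gpredV invgM invgK. Qed.

Fact same_coset_trans : transitive same_coset.
Proof.
move=> y x z xy yz; rewrite /same_coset.
by rewrite -(mulgVK y x) -mulgA gpredM.
Qed.

Canonical same_coset_equiv :=
  EquivRel same_coset same_coset_refl same_coset_sym same_coset_trans.

Definition coset_space := {eq_quot same_coset_equiv}%qT.

HB.instance Definition _ := Quotient.on coset_space.

End Cosets.

Definition is_lattice (R : realType) (n : nat) (G : lieGroupType R n)
    (Gamma : groupClosed G) : Prop :=
  (forall x, x \in Gamma -> isolated [set` Gamma] x) /\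
  compact [set: quotient_topology (coset_space Gamma)].

(* By Lie's theorems the connected and simply connected Lie group with Lie     *)
(* algebra [eps] exists and is unique up to isomorphism, and admitting a       *)
(* lattice is invariant under isomorphism.                                     *)
Definition simply_connected_group_has_lattice (R : realType) (n : nat)
    (eps : n.-tuple 'M[R]_n) : Prop :=
  exists G : lieGroupType R n,
    [/\ simply_connected R G, has_lie_algebra G eps &
        exists Gamma : groupClosed G, is_lattice Gamma].

Section LieAlgebras.
Context {R : realType}.

(* e^{ij}, with i and j in {1, ..., 6} *)
Definition coframe_wedge (i j : nat) : 'M[R]_6 :=
  let E a b := delta_mx (inord a.-1) (inord b.-1) in E i j - E j i.
Local Notation e := coframe_wedge.

Definition g1 : 6.-tuple 'M[R]_6 :=
  [tuple e 1 5; - e 2 5; - e 3 5; e 4 5; 0; 0].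

Definition g2 (alpha : R) : 6.-tuple 'M[R]_6 :=
  [tuple alpha *: e 1 5 + e 2 5; - e 1 5 + alpha *: e 2 5;
         - alpha *: e 3 5 + e 4 5; - e 3 5 - alpha *: e 4 5; 0; 0].

Definition g3 : 6.-tuple 'M[R]_6 :=
  [tuple 0; - e 1 3; e 1 2; 0; - e 4 6; - e 4 5].

Definition g4 : 6.-tuple 'M[R]_6 :=
  [tuple e 2 3; - e 3 6; e 2 6; - e 5 6; e 4 6; 0].

Definition g5 : 6.-tuple 'M[R]_6 :=
  [tuple e 2 4 + e 3 5; e 2 6; e 3 6; - e 4 6; - e 5 6; 0].

Definition g6 : 6.-tuple 'M[R]_6 :=
  [tuple e 2 4 + e 3 5; - e 3 6; e 2 6; - e 5 6; e 4 6; 0].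

Definition g7 : 6.-tuple 'M[R]_6 :=
  [tuple e 2 4 + e 3 5; e 4 6; e 5 6; - e 2 6; - e 3 6; 0].

Definition g8 : 6.-tuple 'M[R]_6 :=
  [tuple e 1 6 - e 2 5; e 1 5 + e 2 6; - e 3 6 + e 4 5; - e 3 5 - e 4 6; 0; 0].

Definition g9 : 6.-tuple 'M[R]_6 :=
  [tuple e 4 5; e 1 5 + e 3 6; e 1 4 - e 2 6 + e 5 6; - e 5 6; e 4 6; 0].

End LieAlgebras.

(* Main.v *)
(* Each group is realized on R^6 with a product x * y = x + y A(x), where A is *)
(* a smooth matrix-valued map with A (x * y) = A y A x. Left translations are  *)
(* then affine, the field x |-> u A(x) is left-invariant, and the bracket is   *)
(* [u, v] = v A'(u) - u A'(v), with A' the differential of A at 0. Such groups *)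
(* are obtained from R^4, from a Heisenberg group or from the free nilpotent   *)
(* group of step 3 on two generators by semidirect products with one-parameter *)
(* groups of linear automorphisms.                                             *)
(*   The coordinates are chosen so that the integer points Z^6 are a lattice:  *)
(* the one-parameter groups have period 1 (rotations), are unipotent, or take  *)
(* at 1 a hyperbolic matrix of SL_2(Z) as value; A is then integral on Z^6,    *)
(* and cocompactness follows from the triangular shape of A. The eigenvalues   *)
(* lambda, 1/lambda of the hyperbolic matrix satisfy lambda + 1/lambda = N;    *)
(* for g_2^alpha this gives the values alpha = ln lambda / (2 pi), N >= 2.     *)

From HB Require Import structures.
From mathcomp Require Import all_boot all_order all_algebra generic_quotient.
From mathcomp Require Import all_classical all_reals all_analysis.
From mathcomp Require Import ring lra.
Require Import Defs.

Set Implicit Arguments.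
Unset Strict Implicit.
Unset Printing Implicit Defensive.

Import Order.TTheory GRing.Theory Num.Theory numFieldNormedType.Exports.

Local Open Scope classical_set_scope.
Local Open Scope ring_scope.

(** * Smooth functions *)

(** Each algebra is a nilpotent ideal extended by commuting one-parameter groups of automorphisms:
    R^4 extended by a plane for g_1, g_2, g_3, g_8 (part of the plane acting trivially for g_1 and
    g_2), a possibly degenerate Heisenberg group extended by a line for g_4, g_5, g_6, g_7, and the
    free nilpotent group of step 3 on two generators extended by a line for g_9. If the
    automorphisms at time 1 preserve the integer points of the ideal, then Z^6 is a lattice in the
    extended group.

    The general theory concerns a product x + y A(x). [translation_field_bracket] computes the
    bracket of left-invariant fields, Schwarz's theorem [derive_symmetric] removing the second-order
    terms, and [affine_group_has_lie_algebra] concludes. [integer_points_lattice] gives the lattice,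
    and [extension], with [extension_arithmetic] and [extension_bracket], carries everything through
    a semidirect product.

    The one-parameter groups come from [cubic_flow]: for X^3 = eps X with eps = -1, 1, 0, the
    exponential is an explicit quadratic polynomial in X, giving rotations, hyperbolic flows and
    unipotent flows. [row_app_has_lattice] then reduces each algebra to an explicit change of basis,
    whose compatibility with the brackets is a rational identity in each coordinate.

    For g_2^alpha a rotation of period 1 is combined with a hyperbolic flow of trace N. Distinct N
    give distinct alpha because N = lambda + 1/lambda; N = 2 corresponds to alpha = 0, realized by
    the rotation alone. *)

Section SmoothCalculus.
Context {R : realType}.
Implicit Types V W : normedModType R.

(** All maps used below are smooth on the whole space, so the calculus is developed on [setT] and
    restricted only where a definition mentions an open subset. *)
Lemma Ck_onW V W k (U : set V) (f : V -> W) : Ck_on k setT f -> Ck_on k U f.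
Proof.
elim: k f => [|k IH] f /=; first by move=> h x _; exact: h.
by move=> [df h]; split=> [x _|v]; [exact: df | exact: IH].
Qed.

Lemma Ck_onS V W k (U : set V) (f : V -> W) : Ck_on k.+1 U f -> Ck_on k U f.
Proof.
elim: k f => [|k IH] f /= [df h].
  by move=> x Ux; exact: differentiable_continuous (df x Ux).
by split=> // v; exact: IH.
Qed.

Lemma Ck_cst V W k (U : set V) (c : W) : Ck_on k U (cst c : V -> W).
Proof.
elim: k c => [|k IH] c /=; first by move=> x _; exact: cst_continuous.
split=> [x _|v]; first exact: differentiable_cst.
rewrite (_ : 'D_v _ = cst 0); first exact: IH.
by apply/funext => x; rewrite derive_cst.
Qed.

Lemma derive_linear V W (f : {linear V -> W}) : continuous f ->
  forall v x, 'D_v f x = f v.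
Proof.
by move=> fc v x; rewrite deriveE ?diff_lin//; exact: linear_differentiable.
Qed.

Lemma Ck_linear V W k (f : {linear V -> W}) : continuous f -> Ck_on k setT f.
Proof.
move=> fc; case: k => [|k] /=; first by move=> x _; exact: fc.
split=> [x _|v]; first exact: linear_differentiable.
rewrite (_ : 'D_v _ = cst (f v)); first exact: Ck_cst.
by apply/funext => x; rewrite derive_linear.
Qed.

Lemma CkD V W k (f g : V -> W) :
  Ck_on k setT f -> Ck_on k setT g -> Ck_on k setT (fun x => f x + g x).
Proof.
elim: k f g => [|k IH] f g /=.
  by move=> fc gc x _; apply: continuousD; [exact: fc | exact: gc].
move=> [df f'] [dg g']; split=> [x _|v].
  by apply: differentiableD; [exact: df | exact: dg].
rewrite (_ : 'D_v _ = fun x => 'D_v f x + 'D_v g x); first exact: IH.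
by apply/funext => x; rewrite -deriveD//; apply: diff_derivable;
  [exact: df | exact: dg].
Qed.

Lemma CkM V k (f g : V -> R) :
  Ck_on k setT f -> Ck_on k setT g -> Ck_on k setT (fun x => f x * g x).
Proof.
elim: k f g => [|k IH] f g.
  by move=> /= fc gc x _; apply: continuousM; [exact: fc | exact: gc].
move=> Cf Cg; have [df f'] := Cf; have [dg g'] := Cg; split=> [x _|v].
  by apply: differentiableM; [exact: df | exact: dg].
rewrite (_ : 'D_v _ = fun x => f x * 'D_v g x + g x * 'D_v f x).
  by apply: CkD; apply: IH; [exact: Ck_onS | exact: g' | exact: Ck_onS | exact:
    f'].
by apply/funext => x; apply: deriveM; apply: diff_derivable;
  [exact: df | exact: dg].
Qed.

Lemma CkN V k (f : V -> R) : Ck_on k setT f -> Ck_on k setT (fun x => - f x).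
Proof.
move=> Cf; rewrite (_ : (fun x => _) = (fun x => -1 * f x)).
  by apply: CkM => //; exact: (Ck_cst k setT (-1 : R)).
by apply/funext => x; rewrite mulN1r.
Qed.

Lemma Ck_sum V k (I : Type) (r : seq I) (P : pred I) (F : I -> V -> R) :
  (forall i, Ck_on k setT (F i)) ->
  Ck_on k setT (fun x => \sum_(i <- r | P i) F i x).
Proof.
move=> CF; elim: r => [|i r IH].
  rewrite (_ : (fun x => _) = cst 0); first exact: Ck_cst.
  by apply/funext => x; rewrite big_nil.
case Pi : (P i).
  rewrite (_ : (fun x => _) = fun x => F i x + \sum_(j <- r | P j) F j x).
    exact: CkD.
  by apply/funext => x; rewrite big_cons Pi.
by under eq_fun do rewrite big_cons Pi.
Qed.

Lemma Ck_prod V k (I : Type) (r : seq I) (P : pred I) (F : I -> V -> R) :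
  (forall i, Ck_on k setT (F i)) ->
  Ck_on k setT (fun x => \prod_(i <- r | P i) F i x).
Proof.
move=> CF; elim: r => [|i r IH].
  rewrite (_ : (fun x => _) = cst 1); first exact: Ck_cst.
  by apply/funext => x; rewrite big_nil.
case Pi : (P i).
  rewrite (_ : (fun x => _) = fun x => F i x * \prod_(j <- r | P j) F j x).
    exact: CkM.
  by apply/funext => x; rewrite big_cons Pi.
by under eq_fun do rewrite big_cons Pi.
Qed.

(** The derivative of 1/f is -(1/f)(1/f) f', which needs 1/f only at one order of smoothness
    less. *)
Lemma CkV V k (f : V -> R) : (forall x, f x != 0) ->
  Ck_on k setT f -> Ck_on k setT (fun x => (f x)^-1).
Proof.
move=> f0; elim: k => [|k IH] Cf.
  by move=> x _; apply: continuousV; [exact: f0 | exact: Cf].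
have [df f'] := Cf; split=> [x _|v]; first by apply: differentiableV;
  [exact: df | exact: f0].
rewrite (_ : 'D_v _ = fun x => - ((f x)^-1 * (f x)^-1) * 'D_v f x).
  by apply: CkM; [apply: CkN; apply: CkM; apply: IH; exact: Ck_onS | exact: f'].
apply/funext => x; rewrite deriveV//; last exact/diff_derivable/df.
by rewrite expr2 invfM.
Qed.

Lemma derive_affine V1 V2 W (l : {linear V1 -> V2}) (a : V2) (f : V2 -> W) v x :
  'D_v (fun y => f (a + l y)) x = 'D_(l v) f (a + l x).
Proof.
have E : (fun h : R => h^-1 *: (((fun y => f (a + l y)) \o shift x) (h *: v)
                                - f (a + l x))) =
         (fun h => h^-1 *: ((f \o shift (a + l x)) (h *: l v) - f (a + l x))).
  by apply/funext => h /=; rewrite (linearD l) (linearZ_LR l) addrCA.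
by rewrite /derive E.
Qed.

Lemma Ck_affine V1 V2 W k (l : {linear V1 -> V2}) (a : V2) (f : V2 -> W) :
  continuous l -> Ck_on k setT f -> Ck_on k setT (fun x => f (a + l x)).
Proof.
move=> lc; have ac : forall x, {for x, continuous (fun y => a + l y)}.
  by move=> x; apply: continuousD; [exact: cst_continuous | exact: lc].
elim: k f => [|k IH] f /=.
  by move=> Cf x _; apply: continuous_comp; [exact: ac | exact: Cf].
move=> [df f']; split=> [x _|v].
  apply: (@differentiable_comp _ _ _ _ (fun y => a + l y) f); last exact: df.
  apply: differentiableD; first exact: differentiable_cst.
  exact: linear_differentiable.
rewrite (_ : 'D_v _ = fun x => 'D_(l v) f (a + l x));
  first exact: (IH ('D_(l v) f) (f' _)).
by apply/funext => x; rewrite derive_affine.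
Qed.

Lemma Ck_comp_linear V1 V2 W k (l : {linear V1 -> V2}) (f : V2 -> W) :
  continuous l -> Ck_on k setT f -> Ck_on k setT (fun x => f (l x)).
Proof.
move=> lc Cf; rewrite (_ : (fun x => _) = fun x => f (0 + l x)).
  exact: Ck_affine.
by apply/funext => x; rewrite add0r.
Qed.

Lemma Ck_row V n k (f : V -> 'rV[R]_n) :
  (forall i, Ck_on k setT (fun x => f x 0 i)) -> Ck_on k setT f.
Proof.
have fE (g : V -> 'rV[R]_n) :
    g = \sum_(i < n) (fun x => g x 0 i *: delta_mx 0 i).
  by apply/funext => x; rewrite fct_sumE [LHS]row_sum_delta.
elim: k f => [|k IH] f /=.
  move=> Cf x _; apply/cvg_ballP => e e0; near=> y; split=> // i j.
  rewrite (ord1 i); move: j; near: y; apply: filter_forall => j.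
  by have /cvg_ballP := Cf j x I; apply.
move=> Cf; have df x : differentiable f x.
  rewrite (fE f); apply: differentiable_sum => i.
  by apply: differentiableZl; have [+ _] := Cf i; apply.
split=> [x _|v]; first exact: df.
apply: IH => i; have [_ /(_ v)] := Cf i; congr Ck_on.
apply/funext => x; rewrite derive_mx ?mxE//; exact: diff_derivable.
Unshelve. all: by end_near. Qed.

End SmoothCalculus.

(** * Symmetry of second derivatives *)

Section Schwarz.
Context {R : realType} {V : normedModType R}.
Implicit Types (f : V -> R) (u v w x : V).

Lemma is_derive_line f w v (t : R) : (forall x, differentiable f x) ->
  is_derive t 1 (fun s : R => f (w + s *: v)) ('D_v f (w + t *: v)).
Proof.
move=> df.
have lin : linear (fun s : R => s *: v) by move=> a b c;
  rewrite scalerDl scalerA.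
pose l : {linear R -> V} := HB.pack (fun s : R => s *: v)
  (GRing.isLinear.Build _ _ _ _ _ lin).
have lc : continuous l by exact: scalel_continuous.
have dl : differentiable (fun s : R => f (w + l s)) t.
  apply: (@differentiable_comp _ _ _ _ (fun s => w + l s) f); last exact: df.
  by apply: differentiableD => //; exact: linear_differentiable.
have /derivableP : derivable (fun s : R => f (w + l s)) t 1.
  exact: diff_derivable.
by rewrite derive_affine /= scale1r.
Qed.

(** The mean value theorem is applied twice: to the difference of f along two parallel lines of
    direction u, then to the derivative of f along u on a line of direction v. *)
Lemma second_difference_MVT f x u v (h : R) : 0 < h ->
    (forall y, differentiable f y) -> (forall y, differentiable ('D_u f) y) ->
  exists s t : R, [/\ 0 <= s <= h, 0 <= t <= h &
    f (x + h *: v + h *: u) - f (x + h *: u) - f (x + h *: v) + f x =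
    h * h * 'D_v ('D_u f) (x + s *: u + t *: v)].
Proof.
move=> h0 df ddf.
pose phi (s : R) := f (x + h *: v + s *: u) - f (x + s *: u).
have dphi (s : R) : is_derive s 1 phi
    ('D_u f (x + h *: v + s *: u) - 'D_u f (x + s *: u)).
  have d1 := @is_derive_line f (x + h *: v) u s df.
  have d2 := @is_derive_line f x u s df.
  exact: is_deriveB.
have cphi : {within `[0, h], continuous phi}.
  apply: derivable_within_continuous => s _.
  exact: (@ex_derive _ _ _ _ _ _ _ (dphi s)).
have [s sh Es] := MVT_segment (ltW h0) (fun s _ => dphi s) cphi.
pose psi (t : R) := 'D_u f (x + s *: u + t *: v).
have dpsi (t : R) := @is_derive_line _ (x + s *: u) v t ddf.
have cpsi : {within `[0, h], continuous psi}.
  apply: derivable_within_continuous => t _.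
  exact: (@ex_derive _ _ _ _ _ _ _ (dpsi t)).
have [t th Et] := MVT_segment (ltW h0) (fun t _ => dpsi t) cpsi.
exists s, t; split; [by move: sh; rewrite in_itv | by move: th;
  rewrite in_itv |].
move: Es Et; rewrite /phi /psi !scale0r !addr0 !subr0 => Es Et.
rewrite (addrAC x (h *: v) (s *: u)) Et in Es.
rewrite mulrC mulrA -Es; ring.
Qed.

(** The second difference over the parallelogram with sides h u and h v is symmetric in u and v.
    Hence one mixed derivative at some point of it equals the other mixed derivative at another
    point; for small h both values are close to those at x, by continuity. *)
Lemma derive_symmetric f u v x : Ck_on 2 setT f ->
  'D_v ('D_u f) x = 'D_u ('D_v f) x.
Proof.
move=> [df Cf].
have {}df y : differentiable f y by exact: df.
have ddf w y : differentiable ('D_w f) y by have [+ _] := Cf w; apply.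
have cddf w1 w2 : continuous ('D_w2 ('D_w1 f)).
  by move=> y; have [_ /(_ w2)] := Cf w1; apply.
apply/eqP; rewrite -subr_eq0 -normr_le0; apply/ler_addgt0Pl => e e0.
rewrite addr0.
have near_x w1 w2 : exists2 d : R, 0 < d & forall s t : R,
    0 <= s <= d -> 0 <= t <= d ->
    `|'D_w2 ('D_w1 f) x - 'D_w2 ('D_w1 f) (x + s *: w1 + t *: w2)| < e / 2.
  have /cvgrPdist_lt /(_ (e / 2) (divr_gt0 e0 (ltr0n _ 2))) := cddf w1 w2 x.
  move=> /nbhs_ballP [r r0 xr].
  (* Adding 1 keeps the denominator positive when both directions are zero. *)
  have M0 : 0 < `|w1| + `|w2| + 1 by rewrite ltr_wpDl// addr_ge0.
  exists (r / 4 / (`|w1| + `|w2| + 1)) => [|s t /andP[s0 sd] /andP[t0 td]].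
    by rewrite !divr_gt0.
  apply: xr; rewrite -ball_normE /ball_ /= -addrA opprD addrA subrr sub0r
    normrN.
  apply: (le_lt_trans (ler_normD _ _)); rewrite !normrZ !ger0_norm//.
  rewrite !ler_pdivlMr// in sd td.
  have := mulr_ge0 s0 (normr_ge0 w1); have := mulr_ge0 s0 (normr_ge0 w2).
  have := mulr_ge0 t0 (normr_ge0 w1); have := mulr_ge0 t0 (normr_ge0 w2).
  by move: sd td r0; rewrite !mulrDr !mulr1 /=; lra.
have [d d0 Hd] := near_x u v; have [d' d'0 Hd'] := near_x v u.
pose h := Num.min d d'.
have h0 : 0 < h by rewrite lt_min d0.
have [s [t [/andP[s0 sh] /andP[t0 th] E]]] :=
  second_difference_MVT x v h0 df (ddf u).
have [s' [t' [/andP[s0' sh'] /andP[t0' th'] E']]] :=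
  second_difference_MVT x u h0 df (ddf v).
have hd : h <= d by rewrite ge_min lexx.
have hd' : h <= d' by rewrite ge_min lexx orbT.
have {}Hd := Hd s t; have {}Hd' := Hd' s' t'.
rewrite s0 t0 /= in Hd; rewrite s0' t0' /= in Hd'.
have {}Hd := Hd (le_trans sh hd) (le_trans th hd).
have {}Hd' := Hd' (le_trans sh' hd') (le_trans th' hd').
have EE : 'D_v ('D_u f) (x + s *: u + t *: v) = 'D_u ('D_v f) (x + s' *: v +
  t' *: u).
  apply: (mulfI (lt0r_neq0 (mulr_gt0 h0 h0))).
  apply: etrans (esym E) _; apply: etrans _ E'.
  have swap (p q r l : R) : p - q - r + l = p - r - q + l by ring.
  by rewrite (addrAC x (h *: u)); exact: swap.
rewrite -EE distrC in Hd'.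
apply: (le_trans (ler_distD ('D_v ('D_u f) (x + s *: u + t *: v)) _ _)).
by rewrite [leRHS]splitr; apply: lerD; apply: ltW; [exact: Hd | exact: Hd'].
Qed.

End Schwarz.

(** * Elementary smooth functions and smooth matrices *)

Section SmoothFunctions.
Context {R : realType}.
Implicit Types V W : normedModType R.

Lemma Ck_comp_lin V1 V2 W k (l : V1 -> V2) (f : V2 -> W) :
  linear l -> continuous l -> Ck_on k setT f -> Ck_on k setT (fun x => f (l x)).
Proof.
move=> ll lc; pose l' : {linear V1 -> V2} := HB.pack l
  (GRing.isLinear.Build _ _ _ _ _ ll).
exact: (@Ck_comp_linear _ _ _ _ _ l').
Qed.

Lemma Ck_lin V W k (f : V -> W) : linear f -> continuous f -> Ck_on k setT f.
Proof.
move=> fl fc; pose f' : {linear V -> W} := HB.pack f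
  (GRing.isLinear.Build _ _ _ _ _ fl).
exact: (@Ck_linear _ _ _ _ f').
Qed.

Lemma Ck_derive1 k (f f' : R -> R) : (forall x : R, is_derive x 1 f (f' x)) ->
  Ck_on k setT f' -> Ck_on k.+1 setT f.
Proof.
move=> df Cf'; have dif x : differentiable f x.
  exact/derivable1_diffP/ex_derive.
split=> [x _|v]; first exact: dif.
rewrite (_ : 'D_v f = fun x => v * f' x).
  by apply: CkM => //; exact: (Ck_cst k setT v).
apply/funext => x; rewrite deriveE// diff1E//= derive1E.
by have [_ ->] := df x.
Qed.

Lemma Ck_expR k : Ck_on k setT (@expR R).
Proof.
elim: k => [|k IH]; first by move=> x _; exact: continuous_expR.
exact: Ck_derive1 IH.
Qed.

Lemma Ck_sin_cos k : Ck_on k setT (@sin R) /\ Ck_on k setT (@cos R).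
Proof.
elim: k => [|k [IHs IHc]].
  by split=> x _; [exact: continuous_sin | exact: continuous_cos].
by split; [exact: Ck_derive1 IHc | exact: Ck_derive1 (CkN IHs)].
Qed.

Lemma Ck_sin k : Ck_on k setT (@sin R). Proof. by case: (Ck_sin_cos k). Qed.
Lemma Ck_cos k : Ck_on k setT (@cos R). Proof. by case: (Ck_sin_cos k). Qed.

Lemma Ck_scaled k (f : R -> R) (a : R) :
  Ck_on k setT f -> Ck_on k setT (fun x => f (a * x)).
Proof.
move=> Cf; apply: (@Ck_comp_lin _ _ _ k (fun x => a * x)) => //.
  by move=> b u v; rewrite mulrDr mulrCA.
exact: mulrl_continuous.
Qed.

Lemma Ck_coord n k (i : 'I_n) : Ck_on k setT (fun x : 'rV[R]_n => x 0 i).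
Proof.
apply: Ck_lin; first by move=> a u v; rewrite !mxE.
by move=> x; exact: coord_continuous.
Qed.

Definition Ck_mx V m n k (A : V -> 'M[R]_(m, n)) :=
  forall i j, Ck_on k setT (fun x => A x i j).

Lemma Ck_mulmx V m n p k (A : V -> 'M[R]_(m, n)) (B : V -> 'M[R]_(n, p)) :
  Ck_mx k A -> Ck_mx k B -> Ck_mx k (fun x => A x *m B x).
Proof.
move=> CA CB i j; under eq_fun do rewrite mxE.
by apply: Ck_sum => l; exact: CkM.
Qed.

Lemma Ck_det V n k (A : V -> 'M[R]_n) :
  Ck_mx k A -> Ck_on k setT (fun x => \det (A x)).
Proof.
move=> CA; apply: Ck_sum => s; apply: CkM; first exact: (Ck_cst _ _ (_ : R)).
by apply: Ck_prod => i; exact: CA.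
Qed.

Lemma Ck_invmx V n k (A : V -> 'M[R]_n) : (forall x, A x \in unitmx) ->
  Ck_mx k A -> Ck_mx k (fun x => invmx (A x)).
Proof.
move=> uA CA i j.
under eq_fun do rewrite /invmx uA !mxE /cofactor.
apply: CkM.
  apply: CkV; last exact: Ck_det.
  by move=> x; have := uA x; rewrite unitmxE unitfE.
apply: CkM; first exact: (Ck_cst _ _ (_ : R)).
by apply: Ck_det => i' j'; under eq_fun do rewrite !mxE; exact: CA.
Qed.

End SmoothFunctions.

(** * Second countability and simple connectedness of R^n *)

Section RowSpace.
Context {R : realType} {n : nat}.
Local Notation rV := 'rV[R]_n.

Lemma rV_second_countable : @second_countable rV.
Proof.
pose c (q : 'rV[rat]_n * nat) : set rV :=
  ball (map_mx (@ratr R) q.1 : rV) q.2.+1%:R^-1.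
exists (range c); first exact: sub_countable (card_image_le _ _) (countableP _).
split=> [_ [q _ <-]|x U /nbhs_ballP [e /= e0 xe]].
  by apply: ball_open; rewrite invr_gt0.
(* A radius below e/2 keeps a ball that contains x inside the ball of radius e around x. *)
have [N _ Ne] : exists2 N : nat, True & N.+1%:R^-1 < e / 2 :> R.
  have := @ltr_add_invr R 0 (e / 2); rewrite divr_gt0// => /(_ isT) [N].
  by rewrite add0r; exists N.
have N0 : 0 < N.+1%:R^-1 :> R by rewrite invr_gt0.
have /choice [q Hq] : forall i : 'I_n, exists q : rat,
    `|x 0 i - ratr q| < N.+1%:R^-1.
  move=> i; have /rat_in_itvoo [q] :
    x 0 i - N.+1%:R^-1 < x 0 i + N.+1%:R^-1
      by rewrite ltrBlDr -addrA ltrDl addr_gt0.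
  rewrite in_itv /= => /andP[q1 q2]; exists q.
  by rewrite distrC ltr_distl q1 q2.
pose y : rV := map_mx (@ratr R) (\row_i q i).
have xy : ball y N.+1%:R^-1 x.
  by split=> // i j; rewrite (ord1 i) /ball /= !mxE distrC.
exists (c (\row_i q i, N)); first by split => //; exists (\row_i q i, N).
move=> z yz; apply: xe; rewrite (splitr e); apply: (@ball_triangle _ _ y).
  by apply: le_ball (ltW Ne) _ _; apply: ball_sym.
by apply: le_ball (ltW Ne) _ _.
Qed.

Lemma rV_simply_connected : simply_connected R rV.
Proof.
split.
  rewrite (_ : [set: rV] = \bigcup_(x in [set: rV]) ((fun s :
    R => s *: x) @` `[0, 1])).
    apply: bigcup_connected => [|x _].
      exists 0 => x _; exists 0; last by rewrite scale0r.
      by rewrite /= in_itv /= lexx ler01.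
    apply: connected_continuous_connected; first exact: segment_connected.
    apply: continuous_subspaceT; exact: scalel_continuous.
  apply/seteqP; split=> // x _; exists x => //.
  by exists 1; [rewrite /= in_itv /= ler01 lexx | rewrite scale1r].
move=> g gc g01.
(* The straight-line contraction of the loop to its base point; the ends stay fixed since g 0 = g
   1. *)
exists (fun p => (1 - p.1) *: g p.2 + p.1 *: g 0); split.
- apply/subspace_continuousP => -[s t] [/= s01 t01].
  have fstc : fst @ within (`[0, 1] `*` `[0, 1]) (nbhs (s, t)) --> (s : R).
    by apply: cvg_trans; [exact: cvg_app (@cvg_within _ _ _ _) | exact:
      cvg_fst].
  have gsndc : g \o snd @ within (`[0, 1] `*` `[0, 1]) (nbhs (s, t)) --> g t.
    move/subspace_continuousP : gc => /(_ t t01); apply: cvg_trans.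
    move=> B /= gB; rewrite /within /=.
    have : \forall p \near (s, t), `[0, 1]%classic p.2 -> B (g p.2).
      exact: (@cvg_snd _ _ (nbhs s) (nbhs t) _ _ gB).
    by apply: filterS => p Bp [_ p2]; exact: Bp.
  apply: cvgD; apply: cvgZ => //; last exact: cvg_cst.
  by apply: cvgB => //; exact: cvg_cst.
- by move=> t _; rewrite subr0 scale1r scale0r addr0.
- by move=> t _; rewrite subrr scale0r scale1r add0r.
- by move=> s _; rewrite -g01 -scalerDl subrK scale1r.
Qed.

End RowSpace.

(** * Lie groups with affine left translations *)

(* The product on R^n is x * y = x + y (lmat x); [lmatM] is its associativity, *)
(* and [lmat x] is the differential of the left translation by x.             *)
Record affine_law (R : realType) (n : nat) := AffineLaw {
  lmat : 'rV[R]_n -> 'M[R]_n;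
  lmat0 : lmat 0 = 1%:M;
  lmatM : forall x y, lmat (x + y *m lmat x) = lmat y *m lmat x;
  lmat_unit : forall x, lmat x \in unitmx;
  lmat_smooth : forall k, Ck_mx k lmat
}.

(** A copy of the row space tagged by the law, so that each law carries its own group and manifold
    structures. *)
Definition affine_group (R : realType) (n : nat) (L : affine_law R n) : Type :=
  'rV[R]_n.

Section AffineGroup.
Context {R : realType} {n : nat} (L : affine_law R n).
Local Notation rV := 'rV[R]_n.
Local Notation A := (lmat L).
Local Notation G := (affine_group L).

Definition affine_mul (x y : rV) : rV := x + y *m A x.
Definition affine_inv (x : rV) : rV := - (x *m invmx (A x)).

Lemma lmat_inv x : A (affine_inv x) = invmx (A x).
Proof.
have := lmatM L x (affine_inv x);
  rewrite /affine_inv mulNmx mulmxKV ?lmat_unit//.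
rewrite subrr lmat0 => /(congr1 (mulmx^~ (invmx (A x)))).
by rewrite mul1mx mulmxK ?lmat_unit.
Qed.

Lemma affine_mulA : associative affine_mul.
Proof.
by move=> x y z; rewrite /affine_mul lmatM mulmxDl -mulmxA addrA.
Qed.

Lemma affine_mul0x : left_id 0 affine_mul.
Proof. by move=> x; rewrite /affine_mul lmat0 mulmx1 add0r. Qed.

Lemma affine_mulx0 : right_id 0 affine_mul.
Proof. by move=> x; rewrite /affine_mul mul0mx addr0. Qed.

Lemma affine_mulVx : left_inverse 0 affine_inv affine_mul.
Proof. by move=> x; rewrite /affine_mul lmat_inv addrC subrr. Qed.

Lemma affine_mulxV : right_inverse 0 affine_inv affine_mul.
Proof.
by move=> x; rewrite /affine_mul mulNmx mulmxKV ?lmat_unit// subrr.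
Qed.

HB.instance Definition _ := Topological.copy G rV.
HB.instance Definition _ := isGroup.Build G
  affine_mulA affine_mul0x affine_mulx0 affine_mulVx affine_mulxV.

Lemma within_id_continuous : {within [set: rV], continuous (id : rV -> rV)}.
Proof. by apply: continuous_subspaceT => x; exact: cvg_id. Qed.

(** A single global chart: every smoothness condition of a Lie group becomes one on maps between row
    spaces. *)
Definition id_chart : chart R n G :=
  @Chart R n G setT setT id id openT openT
    (fun _ _ => I) (fun _ _ => I) (fun _ _ => erefl) (fun _ _ => erefl)
    within_id_continuous within_id_continuous.

Lemma Ck_id k (U : set rV) : Ck_on k U (id : rV -> rV).
Proof. by apply: Ck_onW; apply: Ck_lin => // x; exact: cvg_id. Qed.

Fact id_atlas_cover (x : G) :
  exists2 c, [set id_chart] c & chart_dom c x.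
Proof. by exists id_chart. Qed.

Fact id_atlas_compatible (c d : chart R n G) :
  [set id_chart] c -> [set id_chart] d ->
  smooth_on (chart_cod c `&` chart_inv c @^-1` chart_dom d)
            (chart_map d \o chart_inv c).
Proof. by move=> -> -> k; exact: Ck_id. Qed.

HB.instance Definition _ := Topological_isManifold.Build R n G
  id_atlas_cover id_atlas_compatible (@norm_hausdorff _ rV) rV_second_countable.

Lemma Ck_affine_mul k :
  Ck_on k setT (fun p : rV * rV => affine_mul p.1 p.2).
Proof.
apply: Ck_row => i; under eq_fun do rewrite !mxE.
have Ck_fst (f : rV -> R) : Ck_on k setT f ->
    Ck_on k setT (fun p : rV * rV => f p.1).
  by apply: Ck_comp_lin => // p; exact: cvg_fst.
have Ck_snd (f : rV -> R) : Ck_on k setT f ->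
    Ck_on k setT (fun p : rV * rV => f p.2).
  by apply: Ck_comp_lin => // p; exact: cvg_snd.
apply: CkD; first exact: (Ck_fst _ (Ck_coord k i)).
apply: Ck_sum => j; apply: CkM; first exact: (Ck_snd _ (Ck_coord k j)).
exact: (Ck_fst _ (lmat_smooth L k j i)).
Qed.

Lemma Ck_affine_inv k : Ck_on k setT affine_inv.
Proof.
apply: Ck_row => i; under eq_fun do rewrite !mxE.
apply/CkN/Ck_sum => j; apply: CkM; first exact: Ck_coord.
by apply: Ck_invmx; [exact: lmat_unit | exact: lmat_smooth].
Qed.

Fact affine_mul_continuous :
  continuous (fun p : G * G => (p.1 * p.2)%g).
Proof. by move=> p; exact: (Ck_affine_mul 0) I. Qed.

Fact affine_inv_continuous : continuous (fun x : G => (x^-1)%g).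
Proof. by move=> p; exact: (Ck_affine_inv 0) I. Qed.

Fact affine_mul_smooth (b c d : chart R n G) :
  atlas G b -> atlas G c -> atlas G d ->
  smooth_on [set p | [/\ chart_cod b p.1, chart_cod c p.2 &
                      chart_dom d (chart_inv b p.1 * chart_inv c p.2)%g]]
    (fun p : rV * rV => chart_map d (chart_inv b p.1 * chart_inv c p.2)%g).
Proof. by move=> -> -> -> k; apply: Ck_onW; exact: Ck_affine_mul. Qed.

Fact affine_inv_smooth (c d : chart R n G) :
  atlas G c -> atlas G d ->
  smooth_on [set y | chart_cod c y /\ chart_dom d (chart_inv c y)^-1%g]
    (fun y : rV => chart_map d (chart_inv c y)^-1%g).
Proof. by move=> -> -> k; apply: Ck_onW; exact: Ck_affine_inv. Qed.

HB.instance Definition _ := Manifold_isLieGroup.Build R n G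
  affine_mul_continuous affine_inv_continuous
  affine_mul_smooth affine_inv_smooth.

Lemma affine_group_simply_connected : simply_connected R G.
Proof. exact: rV_simply_connected. Qed.

End AffineGroup.

(** * Left-invariant vector fields and their brackets *)

Section LieAlgebraOfAffineGroup.
Context {R : realType} {n : nat} (L : affine_law R n).
Local Notation rV := 'rV[R]_n.
Local Notation A := (lmat L).
Local Notation G := (affine_group L).

Lemma smooth_funE (f : G -> R) :
  smooth_fun f <-> forall k, Ck_on k [set: rV] (f : rV -> R).
Proof.
split=> [sf k|Cf c ->]; last exact: Cf.
exact: (sf (id_chart L) erefl k).
Qed.

Lemma smooth_fun_differentiable (f : G -> R) (x : G) :
  smooth_fun f -> differentiable (f : rV -> R) x.
Proof. by move=> /smooth_funE /(_ 1%N) [+ _]; apply. Qed.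

Lemma derive_coordE (f : rV -> R) v x : differentiable f x ->
  'D_v f x = \sum_i v 0 i * 'D_(delta_mx 0 i) f x.
Proof.
move=> df; rewrite deriveE// [in LHS](row_sum_delta v) linear_sum.
by apply: eq_bigr => i _; rewrite linearZ deriveE.
Qed.

Lemma mulmxr_continuous (B : 'M[R]_n) : continuous (mulmxr B : rV -> rV).
Proof.
have C k : Ck_on k setT (mulmxr B : rV -> rV).
  apply: Ck_row => i /=; under eq_fun do rewrite mxE.
  apply: Ck_sum => j; apply: CkM; first exact: Ck_coord.
  exact: (Ck_cst k setT (B j i)).
by move=> x; exact: (C 0%N).
Qed.

Lemma derive_translate (f : rV -> R) a v x :
  'D_v (fun y => f (a + y *m A a)) x = 'D_(v *m A a) f (a + x *m A a).
Proof. exact: (derive_affine (mulmxr (A a))). Qed.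

Lemma smooth_fun_translate (a : G) (f : G -> R) :
  smooth_fun f -> smooth_fun (fun x => f (a * x)%g).
Proof.
move=> /smooth_funE Cf; apply/smooth_funE => k.
apply: (Ck_affine (l := mulmxr (A a)) a _ (Cf k)).
exact: mulmxr_continuous.
Qed.

Definition translation_field (w : rV) (f : G -> R) (x : G) : R :=
  'D_(w *m A x) (f : rV -> R) x.

Lemma Ck_frame k (w : rV) i : Ck_on k setT (fun x => (w *m A x) 0 i).
Proof.
under eq_fun do rewrite mxE; apply: Ck_sum => j.
by apply: CkM; [exact: (Ck_cst k setT (w 0 j)) | exact: lmat_smooth].
Qed.

Lemma translation_field_smooth w (f : G -> R) :
  smooth_fun f -> smooth_fun (translation_field w f).
Proof.
move=> sf; apply/smooth_funE => k.
rewrite (_ : translation_field w f = fun x =>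
  \sum_i (w *m A x) 0 i * 'D_(delta_mx 0 i) (f : rV -> R) x); last first.
  apply/funext => x; apply: derive_coordE; exact: smooth_fun_differentiable.
apply: Ck_sum => i; apply: CkM; first exact: Ck_frame.
by have /smooth_funE /(_ k.+1) [_] := sf; apply.
Qed.

Lemma translation_field_left_invariant w :
  left_invariant (translation_field w : (G -> R) -> G -> R).
Proof.
split; first split.
- by move=> x; exists (id_chart L), (w *m A x); split.
- by move=> f; exact: translation_field_smooth.
- move=> a f _ x; rewrite /translation_field.
  have -> : (a * x)%g = a + x *m A a :> rV by [].
  by rewrite lmatM mulmxA; exact: derive_translate.
Qed.

(** Take w to be the tangent vector at the identity; invariance carries it to x by the left
    translation, whose differential is A(x). *)
Lemma left_invariantE (Y : (G -> R) -> G -> R) : left_invariant Y ->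
  exists w, eq_field Y (translation_field w).
Proof.
move=> [[Yt _] Yinv]; have [c [w [-> _ Yw]]] := Yt (1%g : G).
exists w => f sf x; have := Yinv x f sf 1%g.
rewrite mulg1 => <-; rewrite Yw; last exact: smooth_fun_translate.
have := derive_translate f x w 0; rewrite mul0mx addr0; exact.
Qed.

(** The coordinate functions, differentiated at the origin, recover w. *)
Lemma translation_field_inj w w' :
  eq_field (translation_field w :
    (G -> R) -> G -> R) (translation_field w') -> w = w'.
Proof.
move=> ww'; apply/rowP => i.
have sf : smooth_fun ((fun x : rV => x 0 i) : G -> R).
  by apply/smooth_funE => k; exact: Ck_coord.
have dE v (x : rV) : 'D_v (fun x : rV => x 0 i) x = v 0 i.
  have ll : linear (fun x : rV => x 0 i) by move=> a u u'; rewrite !mxE.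
  pose l : {linear rV -> R} := HB.pack (fun x : rV => x 0 i)
    (GRing.isLinear.Build _ _ _ _ _ ll).
  by apply: (derive_linear (f := l)) => y; exact: coord_continuous.
have := ww' _ sf 0; rewrite /translation_field !dE.
by rewrite lmat0 !mulmx1.
Qed.

(* The derivative of X_W f along a vector; its first summand is symmetric in   *)
(* the two fields by Schwarz's theorem and disappears from the bracket.        *)
Lemma derive_field (f : rV -> R) (W : rV -> rV) w x :
    Ck_on 2 setT f -> (forall i, Ck_on 1 setT (fun y => W y 0 i)) ->
  'D_w (fun y => 'D_(W y) f y) x =
  'D_(W x) ('D_w f) x + 'D_(\row_i 'D_w (fun y => W y 0 i) x) f x.
Proof.
move=> Cf CW; have [df Cf'] := Cf.
have {}df y : differentiable f y by exact: df.
have ddf v y : differentiable ('D_v f) y by have [+ _] := Cf' v; apply.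
have dW i y : differentiable (fun y => W y 0 i) y by have [+ _] := CW i; apply.
have E : (fun y => 'D_(W y) f y) =
    \sum_i ((fun y => W y 0 i) * 'D_(delta_mx 0 i) f).
  by apply/funext => y; rewrite fct_sumE; exact: derive_coordE.
apply: etrans (congr1 (fun g => 'D_w g x) E) _.
apply: etrans (derive_sum _) _ => [i|].
  by apply: derivableM; exact: diff_derivable.
have E1 := derive_coordE (W x) (ddf w x).
have E2 := derive_coordE (\row_i 'D_w (fun y => W y 0 i) x) (df x).
apply: etrans _ (esym (congr2 +%R E1 E2)); rewrite -big_split /=.
apply: eq_bigr => i _.
apply: etrans (deriveM _ _) _; try exact: diff_derivable.
apply: congr2; first exact: (congr1 (fun z =>
  W x 0 i * z) (derive_symmetric _ _ _ Cf)).
by rewrite mxE; exact: mulrC.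
Qed.

Definition dlmat (u : rV) : 'M[R]_n :=
  \matrix_(i, j) 'D_u (fun x => A x i j) 0.

(** Associativity reads A(x + y A(x)) = A(y) A(x), so a derivative of A at x reduces to one at the
    origin. *)
Lemma derive_frame u w x :
  \row_i 'D_(u *m A x) (fun y => (w *m A y) 0 i) x = w *m dlmat u *m A x.
Proof.
have dA i j y : differentiable (fun y => A y i j) y.
  by have [+ _] := lmat_smooth L 1 i j; apply.
apply/rowP => i; rewrite mxE.
have := derive_translate (fun y => (w *m A y) 0 i) x u 0.
rewrite mul0mx addr0 => /esym E0; apply: etrans E0 _.
have E : (fun y => (w *m A (x + y *m A x)) 0 i) =
    \sum_j \sum_l ((w 0 l * A x j i) *: (fun y => A y l j)).
  apply/funext => y; rewrite lmatM mulmxA mxE fct_sumE; apply: eq_bigr => j _.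
  rewrite mxE fct_sumE big_distrl; apply: eq_bigr => l _ /=.
  by rewrite mulrAC.
apply: etrans (congr1 (fun g => 'D_u g 0) E) _.
apply: etrans (derive_sum _) _ => [j|].
  by apply: derivable_sum => l; apply/derivableZ/diff_derivable.
rewrite mxE; apply: eq_bigr => j _; rewrite mxE.
apply: etrans (derive_sum _) _ => [l|].
  by apply/derivableZ/diff_derivable.
rewrite big_distrl; apply: eq_bigr => l _.
apply: etrans (deriveZ _ _) _; first exact: diff_derivable.
by rewrite !mxE /= mulrAC.
Qed.

Definition affine_bracket (u v : rV) : rV := v *m dlmat u - u *m dlmat v.

Lemma translation_field_bracket u v :
  eq_field (translation_field (affine_bracket u v) : (G -> R) -> G -> R)
    (field_bracket (translation_field u) (translation_field v)).
Proof.
move=> f sf x; have /smooth_funE Cf := sf.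
have E a b : translation_field a (translation_field b (f : G -> R)) x =
    'D_(b *m A x) ('D_(a *m A x) (f : rV -> R)) x +
    'D_(b *m dlmat a *m A x) (f : rV -> R) x.
  rewrite -derive_frame; apply: (derive_field (W := fun y => b *m A y)) => // i.
  exact: Ck_frame.
have S := derive_symmetric (v *m A x) (u *m A x) x (Cf 2%N).
apply: esym; apply: etrans (congr2 (fun a b => a - b) (E u v) (E v u)) _.
rewrite -S opprD addrACA subrr add0r.
have df := smooth_fun_differentiable x sf.
have dB p q : 'D_(p - q) (f : rV -> R) x = 'D_p (f : rV -> R) x - 'D_q (f :
  rV -> R) x.
  by rewrite !(deriveE _ df) linearB.
by rewrite /translation_field /affine_bracket mulmxBl; exact: esym (dB _ _).
Qed.

(** Q is the change of basis from the basis dual to the e^k to the coordinates of the group. *)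
Lemma affine_group_has_lie_algebra (eps : n.-tuple 'M[R]_n) (Q : 'M[R]_n) :
  Q \in unitmx ->
  (forall u v, ce_bracket eps u v *m Q = affine_bracket (u *m Q) (v *m Q)) ->
  has_lie_algebra G eps.
Proof.
move=> uQ QE; exists (fun u => translation_field (u *m Q)); split.
- by move=> u; exact: translation_field_left_invariant.
- move=> a u v f sf x; rewrite /translation_field.
  have df := smooth_fun_differentiable x sf.
  by rewrite mulmxDl mulmxDl -!scalemxAl !deriveE// linearP.
- move=> Y /left_invariantE [w Yw]; exists (w *m invmx Q); split.
    by rewrite mulmxKV.
  move=> u Yu; apply: (canLR (mulmxK uQ)); apply: translation_field_inj.
  by move=> f sf x; rewrite -Yw// Yu.
- by move=> u v; rewrite QE; exact: translation_field_bracket.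
Qed.

End LieAlgebraOfAffineGroup.

(** * The lattice of integer points *)

Section IntegralMatrices.
Context {R : realType}.

Definition integral_mx m n (A : 'M[R]_(m, n)) : Prop :=
  forall i j, A i j \is a Num.int.

Lemma integral0 m n : integral_mx (0 : 'M[R]_(m, n)).
Proof. by move=> i j; rewrite mxE. Qed.

Lemma integral1 n : integral_mx (1%:M : 'M[R]_n).
Proof. by move=> i j; rewrite mxE. Qed.

Lemma integralD m n (A B : 'M[R]_(m, n)) :
  integral_mx A -> integral_mx B -> integral_mx (A + B).
Proof. by move=> ZA ZB i j; rewrite mxE rpredD. Qed.

Lemma integralN m n (A : 'M[R]_(m, n)) : integral_mx A -> integral_mx (- A).
Proof. by move=> ZA i j; rewrite mxE rpredN. Qed.

Lemma integralM m n p (A : 'M[R]_(m, n)) (B : 'M[R]_(n, p)) :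
  integral_mx A -> integral_mx B -> integral_mx (A *m B).
Proof. by move=> ZA ZB i j; rewrite mxE rpred_sum// => l _; rewrite rpredM. Qed.

End IntegralMatrices.

Section IntegerLattice.
Context {R : realType} {n : nat} (L : affine_law R n).
Local Notation rV := 'rV[R]_n.
Local Notation A := (lmat L).
Local Notation G := (affine_group L).
Hypothesis lmat_int : forall x : rV, integral_mx x -> integral_mx (A x).
Hypothesis lmatV_int :
  forall x : rV, integral_mx x -> integral_mx (invmx (A x)).
Hypothesis lmat_triangular : forall (s : R) (i l j : 'I_n), (i <= j)%N ->
  A (s *: delta_mx 0 i) l j = (l == j)%:R.

Definition integer_points : {pred G} :=
  fun x => (x : rV) \is a mxOver Num.int.

Lemma integer_pointsP (x : G) :
  reflect (integral_mx (x : rV)) (x \in integer_points).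
Proof. exact: mxOverP. Qed.

Lemma integer_points_mul : mulg_closed integer_points.
Proof.
move=> x y /integer_pointsP xZ /integer_pointsP yZ; apply/integer_pointsP.
by apply: integralD => //; apply: integralM => //; exact: lmat_int.
Qed.

Lemma integer_points_inv : invg_closed integer_points.
Proof.
move=> x /integer_pointsP xZ; apply/integer_pointsP.
by apply: integralN; apply: integralM => //; exact: lmatV_int.
Qed.

Lemma integer_points_one : (1%g : G) \in integer_points.
Proof. by apply/integer_pointsP; exact: integral0. Qed.

(* By [lmat_triangular], left multiplication by s e_i adds s to the i-th       *)
(* coordinate and keeps the next ones, so the coordinates can be moved to      *)
(* [0, 1] one after the other, starting from the last one.                     *)
Lemma integer_points_cover (x : G) :
  exists2 g, g \in integer_points & forall j, 0 <= ((g * x)%g : rV) 0 j <= 1.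
Proof.
suff H k : (k <= n)%N -> exists2 g, g \in integer_points &
    forall j : 'I_n, (n - k <= j)%N -> 0 <= ((g * x)%g : rV) 0 j <= 1.
  by have [g gZ gx] := H n (leqnn n); exists g => // j; apply: gx;
    rewrite subnn.
elim: k => [_|k IH kn].
  exists 1%g; first exact: integer_points_one.
  by move=> j; rewrite subn0 leqNgt ltn_ord.
have [g gZ gx] := IH (ltnW kn).
have in_n : (n - k.+1 < n)%N by rewrite ltn_subrL (leq_trans _ kn).
pose i := Ordinal in_n.
pose s : R := - (Num.floor (((g * x)%g : rV) 0 i))%:~R.
pose h : G := s *: delta_mx 0 i.
have hZ : h \in integer_points.
  apply/integer_pointsP => a b; rewrite !mxE rpredM ?rpredN//.
    exact: intr_int.
  exact: natr_int.
exists (h * g)%g; first exact: integer_points_mul.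
move=> j ij; rewrite -mulgA; set y := (g * x)%g in s h hZ gx *.
have -> : ((h * y)%g : rV) 0 j = s * (i == j)%:R + (y : rV) 0 j.
  rewrite [LHS]mxE; congr (_ + _); first by rewrite !mxE eqxx /= eq_sym.
  rewrite mxE (bigD1 j)//= lmat_triangular// eqxx mulr1 big1 ?addr0// => l lj.
  by rewrite lmat_triangular// (negbTE lj) mulr0.
have [<-|nij] := eqVneq i j.
  rewrite mulr1 /s addrC subr_ge0 floor_le /= lerBlDr.
  by have := ltW (floorD1_gt ((y : rV) 0 i)); rewrite intrD addrC.
rewrite mulr0 add0r; apply: gx.
rewrite -subnSK// ltn_neqAle ij andbT.
by apply: contra nij => /eqP e; apply/eqP/val_inj.
Qed.

Lemma integer_points_lattice : exists Gamma : groupClosed G, is_lattice Gamma.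
Proof.
pose Gamma : groupClosed G := HB.pack integer_points
  (isMulClosed.Build G integer_points integer_points_mul)
  (isMul1Closed.Build G integer_points integer_points_one)
  (isInvClosed.Build G integer_points integer_points_inv).
exists Gamma; split=> [x xZ|].
  split; first by rewrite inE.
  (* Distinct integer points differ by at least 1 in some coordinate. *)
  exists (ball (x : rV) (1 / 2)); first by apply: nbhsx_ballx; rewrite divr_gt0.
  apply/seteqP; split=> [y [[_ xy] yZ]|y ->]; last first.
    by split => //; apply: ballxx; rewrite divr_gt0.
  apply/rowP => j; apply/eqP; rewrite -subr_eq0; apply: contraT => nz.
  have : 1 <= `|(y : rV) 0 j - (x : rV) 0 j|.
    apply: norm_intr_ge1 => //; by apply: rpredB; apply/integer_pointsP.
  have := xy 0 j; rewrite /ball /= distrC => lt1 ge1.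
  by have := le_lt_trans ge1 lt1;
    rewrite ltNge ler_pdivrMr// mul1r (ler_nat _ 1 2).
pose box : set rV := [set x | forall i, `[0, 1]%classic (x ord0 i)].
have cbox : compact box.
  by apply: (@rV_compact R n (fun=> `[0, 1]%classic)) => _;
    exact: segment_compact.
(* Every coset meets the unit cube, so the quotient is a continuous image of a compact set. *)
have -> : [set: quotient_topology (coset_space Gamma)] =
    (\pi_(quotient_topology (coset_space Gamma)))%qT @` (box : set G).
  apply/seteqP; split=> // q _; have [g gZ gx] := integer_points_cover (repr q).
  exists (g * repr q)%g; first by move=> j; rewrite /= in_itv /=; exact: gx.
  rewrite -[RHS]reprK; apply/eqmodP.
  by rewrite /= /same_coset mulgK.
apply: continuous_compact => //; apply: continuous_subspaceT.
exact: pi_continuous.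
Qed.

End IntegerLattice.

(** * Semidirect products with one-parameter groups *)

Definition arithmetic (R : realType) n (L : affine_law R n) : Prop :=
  [/\ forall x, integral_mx x -> integral_mx (lmat L x),
      forall x, integral_mx x -> integral_mx (invmx (lmat L x)) &
      forall (s : R) (i l j : 'I_n), (i <= j)%N ->
        lmat L (s *: delta_mx 0 i) l j = (l == j)%:R].

Lemma arithmetic_has_lattice (R : realType) n (L : affine_law R n)
    (eps : n.-tuple 'M[R]_n) (Q : 'M[R]_n) :
  arithmetic L -> Q \in unitmx ->
  (forall u v, ce_bracket eps u v *m Q = affine_bracket L (u *m Q) (v *m Q)) ->
  simply_connected_group_has_lattice eps.
Proof.
move=> [Li LVi Lt] uQ Qb; exists (affine_group L); split.
- exact: affine_group_simply_connected.
- exact: (affine_group_has_lie_algebra (Q := Q)).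
- exact: integer_points_lattice.
Qed.

(** A one-parameter group acting on row vectors; integrality at 1 and -1 propagates to all integer
    times by [flowD]. *)
Record flow (R : realType) (n : nat) := Flow {
  flow_mx : R -> 'M[R]_n;
  flow_smooth : forall k, Ck_mx k flow_mx;
  flowD : forall s t, flow_mx (s + t) = flow_mx s *m flow_mx t;
  flow0 : flow_mx 0 = 1%:M;
  flow1_int : integral_mx (flow_mx 1);
  flowN1_int : integral_mx (flow_mx (-1))
}.

Definition generator (R : realType) n (F : flow R n) (D : 'M[R]_n) : Prop :=
  forall i j, is_derive (0 : R) 1 (fun t => flow_mx F t i j) (D i j).

(** This is the condition for the linear maps x -> x (flow_mx F t) to be automorphisms of the group
    of L: it compares the image of x * y with the product of the images. *)
Definition equivariant (R : realType) n (L : affine_law R n) (F : flow R n) :=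
  forall x t, flow_mx F t *m lmat L (x *m flow_mx F t) =
    lmat L x *m flow_mx F t.

Section Flows.
Context {R : realType}.

Lemma derive_comp_lin (V1 V2 W : normedModType R) (l : V1 -> V2) (f :
  V2 -> W) v x :
  linear l -> 'D_v (fun y => f (l y)) x = 'D_(l v) f (l x).
Proof.
move=> ll; pose l' : {linear V1 -> V2} := HB.pack l
  (GRing.isLinear.Build _ _ _ _ _ ll).
have := derive_affine l' 0 f v x; rewrite add0r => <-.
by congr ('D_v _ x); apply/funext => y; rewrite add0r.
Qed.

Lemma flow_int n (F : flow R n) (t : R) :
  t \is a Num.int -> integral_mx (flow_mx F t).
Proof.
have natf (k : nat) : integral_mx (flow_mx F k%:R) /\ integral_mx (flow_mx F (-
  k%:R)).
  elim: k => [|k [IH1 IH2]].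
    by rewrite oppr0 flow0; split; exact: integral1.
  rewrite -addn1 natrD opprD !flowD; split; apply: integralM => //.
    exact: flow1_int.
  exact: flowN1_int.
move=> /intrP [m ->]; case: m => k; first by case: (natf k).
by rewrite NegzE mulrNz; case: (natf k.+1).
Qed.

Lemma flowN n (F : flow R n) t : flow_mx F t *m flow_mx F (- t) = 1%:M.
Proof. by rewrite -flowD subrr flow0. Qed.

Lemma is_derive_mulmx (V : normedModType R) m n p (x u : V)
    (A : V -> 'M[R]_(m, n)) (B : V -> 'M[R]_(n, p)) (dA : 'M[R]_(m, n)) (dB :
      'M[R]_(n, p)) i j :
  (forall i j, is_derive x u (fun t => A t i j) (dA i j)) ->
  (forall i j, is_derive x u (fun t => B t i j) (dB i j)) ->
  is_derive x u (fun t => (A t *m B t) i j) ((A x *m dB + dA *m B x) i j).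
Proof.
move=> hA hB.
have -> : (fun t => (A t *m B t) i j) =
    \sum_l ((fun t => A t i l) * (fun t => B t l j)).
  by apply/funext => t; rewrite mxE fct_sumE.
have D l : is_derive x u ((fun t => A t i l) * (fun t => B t l j))
    (A x i l *: dB l j + B x l j *: dA i l) by exact: is_deriveM.
apply: is_derive_eq (is_derive_sum D) _.
rewrite !mxE -big_split /=; apply: eq_bigr => l _.
by congr (_ + _); exact: mulrC.
Qed.

Lemma Ck_cst_mx (V : normedModType R) m n k (A : 'M[R]_(m, n)) :
  Ck_mx k (fun _ : V => A).
Proof. by move=> i j; exact: (Ck_cst k setT (A i j)). Qed.

Definition trivial_flow n : flow R n :=
  @Flow R n (fun=> 1%:M) (fun k => @Ck_cst_mx R n n k 1%:M) (fun _ _ =>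
    esym (mulmx1 _)) erefl
    (@integral1 R n) (@integral1 R n).

Lemma trivial_generator n : generator (trivial_flow n) 0.
Proof.
move=> i j; have -> : (0 : 'M[R]_n) i j = 0 by rewrite mxE.
exact: (is_derive_cst ((1%:M : 'M[R]_n) i j) (0 : R) 1).
Qed.

Section ProductFlow.
Context {n : nat} (F G : flow R n).
Hypothesis FG : forall s t, flow_mx F s *m flow_mx G t =
  flow_mx G t *m flow_mx F s.

Let prod_mx t := flow_mx F t *m flow_mx G t.

Fact prod_smooth k : Ck_mx k prod_mx.
Proof. by apply: Ck_mulmx; exact: flow_smooth. Qed.

Fact prodD s t : prod_mx (s + t) = prod_mx s *m prod_mx t.
Proof. by rewrite /prod_mx !flowD !mulmxA -(mulmxA _ _ (flow_mx G s)) FG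
  !mulmxA. Qed.

Fact prod0 : prod_mx 0 = 1%:M.
Proof. by rewrite /prod_mx !flow0 mulmx1. Qed.

Fact prod1_int : integral_mx (prod_mx 1).
Proof. by apply: integralM; exact: flow1_int. Qed.

Fact prodN1_int : integral_mx (prod_mx (-1)).
Proof. by apply: integralM; exact: flowN1_int. Qed.

Definition product_flow := Flow prod_smooth prodD prod0 prod1_int prodN1_int.

Lemma product_generator D E :
  generator F D -> generator G E -> generator product_flow (D + E).
Proof.
move=> FD GE i j; have := is_derive_mulmx i j FD GE.
by rewrite !flow0 mulmx1 mul1mx addrC.
Qed.

Lemma product_equivariant (L : affine_law R n) :
  equivariant L F -> equivariant L G -> equivariant L product_flow.
Proof. by move=> eF eG x t /=;
  rewrite /prod_mx mulmxA -mulmxA eG mulmxA eF mulmxA. Qed.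

End ProductFlow.

Lemma Ck_block_mx (V : normedModType R) m1 m2 n1 n2 k
    (A : V -> 'M[R]_(m1, n1)) (B : V -> 'M[R]_(m1, n2))
    (C : V -> 'M[R]_(m2, n1)) (D : V -> 'M[R]_(m2, n2)) :
  Ck_mx k A -> Ck_mx k B -> Ck_mx k C -> Ck_mx k D ->
  Ck_mx k (fun x => block_mx (A x) (B x) (C x) (D x)).
Proof.
move=> CA CB CC CD i j.
case: (split_ordP i) => i' ->; case: (split_ordP j) => j' ->.
- by under eq_fun do rewrite block_mxEul; exact: CA.
- by under eq_fun do rewrite block_mxEur; exact: CB.
- by under eq_fun do rewrite block_mxEdl; exact: CC.
- by under eq_fun do rewrite block_mxEdr; exact: CD.
Qed.

Lemma is_derive_block_mx (V : normedModType R) m1 m2 n1 n2 (x u : V)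
    (A : V -> 'M[R]_(m1, n1)) (B : V -> 'M[R]_(m1, n2))
    (C : V -> 'M[R]_(m2, n1)) (D : V -> 'M[R]_(m2, n2)) dA dB dC dD i j :
  (forall i j, is_derive x u (fun t => A t i j) ((dA : 'M[R]_(m1, n1)) i j)) ->
  (forall i j, is_derive x u (fun t => B t i j) ((dB : 'M[R]_(m1, n2)) i j)) ->
  (forall i j, is_derive x u (fun t => C t i j) ((dC : 'M[R]_(m2, n1)) i j)) ->
  (forall i j, is_derive x u (fun t => D t i j) ((dD : 'M[R]_(m2, n2)) i j)) ->
  is_derive x u (fun t => block_mx (A t) (B t) (C t) (D t) i j)
    (block_mx dA dB dC dD i j).
Proof.
move=> CA CB CC CD.
case: (split_ordP i) => i' ->; case: (split_ordP j) => j' ->.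
- by under eq_fun do rewrite block_mxEul; rewrite block_mxEul; exact: CA.
- by under eq_fun do rewrite block_mxEur; rewrite block_mxEur; exact: CB.
- by under eq_fun do rewrite block_mxEdl; rewrite block_mxEdl; exact: CC.
- by under eq_fun do rewrite block_mxEdr; rewrite block_mxEdr; exact: CD.
Qed.

Lemma is_derive_cst_mx (V : normedModType R) m n (x u : V) (A :
  'M[R]_(m, n)) i j :
  is_derive x u (fun _ => A i j) ((0 : 'M[R]_(m, n)) i j).
Proof.
have -> : (0 : 'M[R]_(m, n)) i j = 0 by rewrite mxE.
exact: (is_derive_cst (A i j) x u).
Qed.

Lemma integral_block_mx m1 m2 n1 n2
    (A : 'M[R]_(m1, n1)) (B : 'M[R]_(m1, n2))
    (C : 'M[R]_(m2, n1)) (D : 'M[R]_(m2, n2)) :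
  integral_mx A -> integral_mx B -> integral_mx C -> integral_mx D ->
  integral_mx (block_mx A B C D).
Proof.
move=> CA CB CC CD i j.
case: (split_ordP i) => i' ->; case: (split_ordP j) => j' ->.
- by rewrite block_mxEul.
- by rewrite block_mxEur.
- by rewrite block_mxEdl.
- by rewrite block_mxEdr.
Qed.

Section StabilizedFlow.
Context {n : nat} (F : flow R n).

Let stab_mx t : 'M[R]_(n + 1) := block_mx (flow_mx F t) 0 0 1%:M.

Fact stab_smooth k : Ck_mx k stab_mx.
Proof. by apply: Ck_block_mx; [exact: flow_smooth | exact: Ck_cst_mx..]. Qed.

Fact stabD s t : stab_mx (s + t) = stab_mx s *m stab_mx t.
Proof.
by rewrite /stab_mx mulmx_block !(mulmx0, mul0mx) !addr0 !add0r mulmx1 flowD.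
Qed.

Fact stab0 : stab_mx 0 = 1%:M.
Proof. by rewrite /stab_mx flow0 -scalar_mx_block. Qed.

Fact stab1_int : integral_mx (stab_mx 1).
Proof.
by apply: integral_block_mx; [exact: flow1_int | exact: integral0.. | exact:
  integral1].
Qed.

Fact stabN1_int : integral_mx (stab_mx (-1)).
Proof.
by apply: integral_block_mx; [exact: flowN1_int | exact: integral0.. | exact:
  integral1].
Qed.

Definition stabilized_flow := Flow stab_smooth stabD stab0 stab1_int stabN1_int.

Lemma stabilized_generator D :
  generator F D -> generator stabilized_flow (block_mx D 0 0 0).
Proof.
move=> FD i j; apply: is_derive_block_mx; first exact: FD.
all: exact: is_derive_cst_mx.
Qed.

End StabilizedFlow.

Section Extension.
Context {n : nat} (L : affine_law R n) (F : flow R n).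
Hypothesis eqF : equivariant L F.
Local Notation A := (lmat L).
Local Notation rV := 'rV[R]_(n + 1).

Let time (y : rV) : R := rsubmx y 0 0.

(* (v, t) * (w, s) = (v * (w (flow_mx F t)), t + s)                            *)
Definition ext_mx (y : rV) : 'M[R]_(n + 1) :=
  block_mx (flow_mx F (time y) *m A (lsubmx y)) 0 0 1%:M.

Fact ext_mx0 : ext_mx 0 = 1%:M.
Proof.
by rewrite /ext_mx /time !linear0 mxE flow0 lmat0 mulmx1 -scalar_mx_block.
Qed.

Fact ext_mxM x y : ext_mx (x + y *m ext_mx x) = ext_mx y *m ext_mx x.
Proof.
rewrite -[x]hsubmxK -[y]hsubmxK; set v := lsubmx x; set w := lsubmx y.
rewrite /ext_mx /time mul_row_block !mulmx0 addr0 add0r mulmx1 add_row_mx.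
rewrite !row_mxKl !row_mxKr mulmx_block !(mulmx0, mul0mx) !addr0 !add0r mulmx1.
rewrite [X in flow_mx F X]mxE addrC flowD (mulmxA w) lmatM.
congr block_mx; rewrite -!mulmxA; congr (_ *m _).
by rewrite !mulmxA eqF.
Qed.

Fact ext_mx_inv y : ext_mx y *m
  block_mx (invmx (A (lsubmx y)) *m flow_mx F (- time y)) 0 0 1%:M = 1%:M.
Proof.
rewrite mulmx_block !(mulmx0, mul0mx) !addr0 !add0r mulmx1.
by rewrite -mulmxA mulKVmx ?lmat_unit// flowN -scalar_mx_block.
Qed.

Fact ext_unit y : ext_mx y \in unitmx.
Proof. by have [] := mulmx1_unit (ext_mx_inv y). Qed.

Let time_linear : linear time.
Proof. by move=> a u v; rewrite /time !mxE. Qed.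

Let time_continuous : continuous time.
Proof.
rewrite (_ : time = fun y => y 0 (rshift n 0)).
  by move=> x; exact: coord_continuous.
by apply/funext => y; rewrite /time mxE.
Qed.

Let lsubmx_linear : linear (lsubmx : rV -> 'rV[R]_n).
Proof. by move=> a u v; rewrite linearP. Qed.

Let lsubmx_continuous : continuous (lsubmx : rV -> 'rV[R]_n).
Proof.
have C k : Ck_on k setT (lsubmx : rV -> 'rV[R]_n).
  apply: Ck_row => i; under eq_fun do rewrite mxE; exact: Ck_coord.
by move=> x; exact: (C 0%N).
Qed.

Let Ck_flow_time k : Ck_mx k (fun y => flow_mx F (time y)).
Proof.
move=> i j; apply: (Ck_comp_lin (l := time) (f :=
  fun t => flow_mx F t i j)) => //.
exact: flow_smooth.
Qed.

Let Ck_lmat_lsubmx k : Ck_mx k (fun y : rV => A (lsubmx y)).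
Proof.
move=> i j; apply: (Ck_comp_lin (l := lsubmx) (f := fun v => A v i j)) => //.
exact: lmat_smooth.
Qed.

Fact ext_smooth k : Ck_mx k ext_mx.
Proof. by apply: Ck_block_mx; [exact: Ck_mulmx | exact: Ck_cst_mx..]. Qed.

Definition extension : affine_law R (n + 1) :=
  AffineLaw ext_mx0 ext_mxM ext_unit ext_smooth.

(** Time is the last coordinate, which preserves the triangular shape: a translation by s e_i with i
    not the time has time 0, so the flow contributes the identity and the hypothesis on L
    applies. *)
Lemma extension_arithmetic : arithmetic L -> arithmetic extension.
Proof.
move=> [Li LVi Lt]; split=> [y yZ|y yZ|s i l j ij] /=.
- apply: integral_block_mx; [|exact: integral0..|exact: integral1].
  apply: integralM; first by apply: flow_int; rewrite /time mxE.
  by apply: Li => a b; rewrite mxE.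
- have -> : invmx (ext_mx y) =
    block_mx (invmx (A (lsubmx y)) *m flow_mx F (- time y)) 0 0 1%:M.
    by rewrite -[LHS]mulmx1 -(ext_mx_inv y) mulKmx// ext_unit.
  apply: integral_block_mx; [|exact: integral0..|exact: integral1].
  apply: integralM; first by apply: LVi => a b; rewrite mxE.
  by apply: flow_int; rewrite rpredN /time mxE.
rewrite /ext_mx /time.
case: (split_ordP i) ij => i' ->; case: (split_ordP j) => j' -> /= ij;
  case: (split_ordP l) => l' ->.
- have -> : rsubmx (s *: delta_mx 0 (lshift 1 i') : rV) 0 0 = 0 :> R.
    by rewrite !mxE eq_rlshift mulr0.
  have -> : lsubmx (s *: delta_mx 0 (lshift 1 i')) =
    s *: delta_mx 0 i' :> 'rV[R]_n.
    by apply/rowP => a; rewrite !mxE eq_lshift.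
  by rewrite flow0 mul1mx block_mxEul Lt// eq_lshift.
- by rewrite block_mxEdl mxE eq_rlshift.
- by rewrite block_mxEur mxE eq_lrshift.
- by rewrite block_mxEdr mxE eq_rshift.
- by move: ij; rewrite leqNgt (leq_trans (ltn_ord j'))// leq_addr.
- by move: ij; rewrite leqNgt (leq_trans (ltn_ord j'))// leq_addr.
- by rewrite block_mxEur mxE eq_lrshift.
- by rewrite block_mxEdr mxE eq_rshift.
Qed.

(** This is the product rule at the origin, where both factors are the identity. *)
Lemma extension_dlmat D x : generator F D ->
  dlmat extension x = block_mx (dlmat L (lsubmx x) + time x *: D) 0 0 0.
Proof.
move=> FD.
have is_derive_C1 (f : rV -> R) d :
  Ck_on 1 setT f -> 'D_x f 0 = d -> is_derive 0 x f d.
  move=> [df _] <-; apply: derivableP; apply: diff_derivable; exact: df.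
have dF i j : is_derive (0 : rV) x (fun y =>
  flow_mx F (time y) i j) ((time x *: D) i j).
  apply: is_derive_C1; first exact: Ck_flow_time.
  apply: etrans (derive_comp_lin (fun t => flow_mx F t i j) _ _ time_linear) _.
  have t0 : time 0 = 0 by rewrite /time !mxE.
  have [df _] := flow_smooth F 1 i j.
  rewrite t0 deriveE; last exact: df.
  rewrite diff1E; last exact: df.
  by rewrite derive1E (@derive_val _ _ _ _ _ _ _ (FD i j)) mxE.
have dA i j : is_derive (0 : rV) x (fun y =>
  A (lsubmx y) i j) (dlmat L (lsubmx x) i j).
  apply: is_derive_C1; first exact: Ck_lmat_lsubmx.
  apply: etrans (derive_comp_lin (fun v => A v i j) _ _ lsubmx_linear) _.
  by rewrite linear0 mxE.
apply/matrixP => i j; rewrite mxE.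
have dFA i' j' := is_derive_mulmx i' j' dF dA.
have := is_derive_block_mx i j dFA (is_derive_cst_mx (0 : rV) x 0)
  (is_derive_cst_mx (0 : rV) x 0) (is_derive_cst_mx (0 : rV) x 1%:M).
move=> /(@derive_val _ _ _ _ _ _ _) ->.
have t0 : time 0 = 0 by rewrite /time linear0 mxE.
by rewrite t0 linear0 lmat0 flow0 mul1mx mulmx1.
Qed.

Lemma extension_bracket D : generator F D -> forall x y : rV,
  affine_bracket extension x y =
  row_mx (affine_bracket L (lsubmx x) (lsubmx y)
          + (time x *: (lsubmx y *m D) - time y *: (lsubmx x *m D))) 0.
Proof.
move=> FD x y; rewrite /affine_bracket !(extension_dlmat _ FD).
rewrite -{1}[y]hsubmxK -{3}[x]hsubmxK !mul_row_block !mulmx0 !addr0.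
rewrite opp_row_mx add_row_mx subrr; congr row_mx.
by rewrite !mulmxDr !scalemxAr opprD addrACA.
Qed.

End Extension.

End Flows.

Lemma derive_affine_lin (R : realType) (V W : normedModType R) (l : V -> W)
    (c : W) v x : linear l -> 'D_v (fun y => c + l y) x = l v.
Proof.
move=> ll; pose l' : {linear V -> W} := HB.pack l
  (GRing.isLinear.Build _ _ _ _ _ ll).
by rewrite (derive_affine l' c id) derive_id.
Qed.

(** * The abelian group R^n *)

Section AbelianLaw.
Context {R : realType} (n : nat).

Definition abelian_law : affine_law R n :=
  @AffineLaw R n (fun=> 1%:M) erefl (fun _ _ => esym (mulmx1 _))
    (fun=> unitmx1 _ _) (fun k => @Ck_cst_mx R 'rV[R]_n n n k 1%:M).

Lemma abelian_arithmetic : arithmetic abelian_law.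
Proof.
split=> [x _|x _|s i l j _] /=; rewrite ?invmx1; try exact: integral1.
by rewrite mxE.
Qed.

Lemma abelian_equivariant F : equivariant abelian_law F.
Proof. by move=> x t /=; rewrite mulmx1 mul1mx. Qed.

Lemma abelian_bracket x y : affine_bracket abelian_law x y = 0.
Proof.
have d0 u : dlmat abelian_law u = 0.
  apply/matrixP => i j; rewrite [LHS]mxE [RHS]mxE.
  exact: (derive_cst ((1%:M : 'M[R]_n) i j)).
by rewrite /affine_bracket !d0 !mulmx0 subrr.
Qed.

(** A second flow acts on R^n extended by F, leaving the time of F fixed; it acts by automorphisms
    because it commutes with F. *)
Lemma stabilized_equivariant (F G : flow R n) :
  (forall s t, flow_mx F s *m flow_mx G t = flow_mx G t *m flow_mx F s) ->
  equivariant (extension (abelian_equivariant F)) (stabilized_flow G).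
Proof.
move=> FG x t; rewrite /= /ext_mx /= -[x]hsubmxK mul_row_block.
rewrite !mulmx0 addr0 add0r mulmx1 !row_mxKr !mulmx_block.
by rewrite !(mulmx0, mul0mx) !addr0 !add0r !mulmx1 FG.
Qed.

End AbelianLaw.

(** * Heisenberg groups, possibly with degenerate form *)

Section HeisenbergLaw.
Context {R : realType} (n : nat) (W : 'M[R]_n.+1).
Hypothesis WT : W^T = - W.
Hypothesis W0 : (delta_mx 0 0 : 'rV_n.+1) *m W = 0.
Local Notation e := (delta_mx 0 0 : 'rV[R]_n.+1).

(* (z, v) * (z', v') = (z + z' + v W v'^T, v + v'), where z is the first       *)
(* coordinate.                                                                 *)
Definition heis_mx (x : 'rV[R]_n.+1) : 'M[R]_n.+1 := 1%:M + (x *m W)^T *m e.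

(** The vanishing of these products, due to e W = 0, makes [heis_mx] turn sums into products. *)
Lemma heis_square x y : (x *m W)^T *m e *m ((y *m W)^T *m e) = 0.
Proof.
have eW : e *m (y *m W)^T = 0.
  by rewrite trmx_mul WT mulNmx mulmxN mulmxA W0 mul0mx oppr0.
by rewrite mulmxA -(mulmxA _ e) eW mulmx0 mul0mx.
Qed.

Fact heis_mx0 : heis_mx 0 = 1%:M.
Proof. by rewrite /heis_mx mul0mx trmx0 mul0mx addr0. Qed.

Fact heis_mxM x y : heis_mx (x + y *m heis_mx x) = heis_mx y *m heis_mx x.
Proof.
have EW : (x + y *m heis_mx x) *m W = x *m W + y *m W.
  rewrite /heis_mx mulmxDr mulmx1 mulmxA !mulmxDl -(mulmxA _ e W) W0 mulmx0.
  by rewrite addr0.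
rewrite {1}/heis_mx EW linearD mulmxDl /heis_mx.
rewrite mulmxDl mul1mx mulmxDr mulmx1 heis_square addr0.
by rewrite addrA.
Qed.

Fact heis_mxN x : heis_mx x *m heis_mx (- x) = 1%:M.
Proof.
rewrite /heis_mx mulmxDl mul1mx mulmxDr mulmx1 heis_square addr0 -addrA.
by rewrite -mulmxDl -linearD -mulmxDl addNr mul0mx linear0 mul0mx addr0.
Qed.

Fact heis_unit x : heis_mx x \in unitmx.
Proof. by have [] := mulmx1_unit (heis_mxN x). Qed.

Lemma heis_mxE x i j : heis_mx x i j = (i == j)%:R + (x *m W) 0 i * (j == 0)%:R.
Proof. by rewrite !mxE big_ord1 !mxE eqxx. Qed.

Fact heis_smooth k : Ck_mx k heis_mx.
Proof.
move=> i j; under eq_fun do rewrite heis_mxE.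
apply: CkD; first exact: (Ck_cst k setT ((i == j)%:R : R)).
apply: CkM; last exact: (Ck_cst k setT ((j == 0)%:R : R)).
under eq_fun do rewrite mxE.
apply: Ck_sum => l; apply: CkM; first exact: Ck_coord.
exact: (Ck_cst k setT (W l i)).
Qed.

Definition heis_law : affine_law R n.+1 :=
  AffineLaw heis_mx0 heis_mxM heis_unit heis_smooth.

Lemma heis_arithmetic : integral_mx W -> arithmetic heis_law.
Proof.
move=> ZW; have Zh x : integral_mx x -> integral_mx (heis_mx x).
  move=> Zx i j; rewrite heis_mxE rpredD ?rpredM//; try exact: natr_int.
  exact: integralM.
split=> [x Zx|x Zx|s i l j ij] /=; first exact: Zh.
  have -> : invmx (heis_mx x) = heis_mx (- x).
    by rewrite -[LHS]mulmx1 -(heis_mxN x) mulKmx// heis_unit.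
  exact/Zh/integralN.
rewrite heis_mxE; have [j0|] := eqVneq j 0; last by rewrite mulr0 addr0.
have -> : i = 0 by apply/val_inj/eqP; rewrite -leqn0 (leq_trans ij)// j0.
by rewrite -scalemxAl W0 scaler0 mxE mul0r addr0.
Qed.

(** The two terms of the bracket are equal by antisymmetry of W, whence the factor 2. *)
Lemma heis_bracket x y : affine_bracket heis_law x y =
  ((x *m W *m y^T) 0 0 *+ 2) *: e.
Proof.
have dh u : dlmat heis_law u = (u *m W)^T *m e.
  apply/matrixP => i j; rewrite [LHS]mxE.
  have ll : linear (fun x : 'rV[R]_n.+1 => (x *m W) 0 i * (j == 0)%:R).
    by move=> a v w; rewrite mulmxDl -scalemxAl !mxE mulrDl -mulrA.
  have -> : (fun x => lmat heis_law x i j) =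
      (fun x => (i == j)%:R + (x *m W) 0 i * (j == 0)%:R).
    by apply/funext => v; exact: heis_mxE.
  by rewrite (derive_affine_lin _ _ _ ll) !mxE big_ord1 !mxE eqxx.
rewrite /affine_bracket !dh !mulmxA.
have sc (a b : 'rV[R]_n.+1) : b *m (a *m W)^T *m e = (a *m W *m b^T) 0 0 *: e.
  have -> : b *m (a *m W)^T = (a *m W *m b^T)^T by rewrite [RHS]trmx_mul trmxK.
  by rewrite [(_)^T]mx11_scalar mul_scalar_mx mxE.
have W_sym : (y *m W *m x^T) 0 0 = - (x *m W *m y^T) 0 0.
  have -> : y *m W *m x^T = - (x *m W *m y^T)^T.
    by rewrite !trmx_mul trmxK WT mulNmx mulmxN opprK mulmxA.
  by rewrite !mxE.
by rewrite !sc W_sym scaleNr opprK -scalerDl -mulr2n.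
Qed.

(** Preserving W and fixing the central vector e amounts to preserving the cocycle of the
    product. *)
Lemma heis_equivariant (F : flow R n.+1) :
  (forall t, flow_mx F t *m W *m (flow_mx F t)^T = W) ->
  (forall t, e *m flow_mx F t = e) -> equivariant heis_law F.
Proof.
move=> FW Fe x t /=; rewrite /heis_mx mulmxDr mulmxDl mulmx1 mul1mx.
congr (_ + _); rewrite -[RHS]mulmxA Fe mulmxA; congr (_ *m _).
rewrite -[LHS]trmxK; congr trmx.
by rewrite trmx_mul trmxK -!mulmxA (mulmxA (flow_mx F t)) FW.
Qed.

End HeisenbergLaw.

(** * Exponentials of matrices with X^3 = eps X *)

Section CubicFlows.
Context {R : realType} {n : nat}.
Implicit Types (X Y : 'M[R]_n) (F : flow R n).

(* When X^3 = eps X, the exponential of t X is of the form 1 + f X + g X^2;    *)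
(* the last equation says that it is inverse to that of - t X.                 *)
Definition cubic_form (eps : R) F X := forall t, exists f g : R,
  [/\ flow_mx F t = 1%:M + f *: X + g *: (X *m X),
      flow_mx F (- t) = 1%:M - f *: X + g *: (X *m X) &
      2 * g = f ^+ 2 - eps * g ^+ 2].

Lemma comm_mxZ (A B : 'M[R]_n) (c : R) : comm_mx A B -> comm_mx A (c *: B).
Proof. by rewrite /comm_mx -scalemxAl -scalemxAr => ->. Qed.

(** Since the flow is a polynomial in X, algebraic properties of X pass to it without any
    differential equation. *)
Lemma cubic_form_comm eps F X (B : 'M[R]_n) t :
  cubic_form eps F X -> comm_mx B X -> comm_mx B (flow_mx F t).
Proof.
move=> cF BX; have [f [g [-> _ _]]] := cF t.
apply: comm_mxD; last by apply: comm_mxZ; exact: comm_mxM.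
by apply: comm_mxD; [exact: comm_mx1 | exact: comm_mxZ].
Qed.

Lemma cubic_form_row eps F X (e : 'rV[R]_n) t :
  cubic_form eps F X -> e *m X = 0 -> e *m flow_mx F t = e.
Proof.
move=> cF eX; have [f [g [-> _ _]]] := cF t.
by rewrite !mulmxDr -!scalemxAr mulmxA eX mul0mx !scaler0 mulmx1 !addr0.
Qed.

(** Moving X across W replaces it by minus its transpose; f changes sign and g does not, which gives
    the transposed flow at the opposite time. *)
Lemma cubic_form_form eps F X (W : 'M[R]_n) t :
  cubic_form eps F X -> X *m W = - (W *m X^T) ->
  flow_mx F t *m W *m (flow_mx F t)^T = W.
Proof.
move=> cF XW.
have FW s : flow_mx F s *m W = W *m (flow_mx F (- s))^T.
  have [f [g [-> -> _]]] := cF s.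
  have -> : (1%:M - f *: X + g *: (X *m X))^T =
      1%:M - f *: X^T + g *: (X^T *m X^T).
    by rewrite linearD linearB !linearZ /= trmx_mul trmx1.
  rewrite !mulmxDr !mulmxDl mulmx1 mul1mx mulmxN -!scalemxAl -!scalemxAr.
  by rewrite -(mulmxA X) XW scalerN mulmxN mulmxA XW mulNmx opprK mulmxA.
by rewrite FW -mulmxA -trmx_mul flowN trmx1 mulmx1.
Qed.

Section Cubic.
Variables (eps : R) (X : 'M[R]_n) (f g : R -> R).
Hypothesis X3 : X *m X *m X = eps *: X.
Hypothesis Cf : forall k, Ck_on k setT f.
Hypothesis Cg : forall k, Ck_on k setT g.
Hypothesis fD : forall s t, f (s + t) = f s + f t + eps * (f s * g t +
  g s * f t).
Hypothesis gD : forall s t, g (s + t) = g s + g t + f s * f t + eps * g s * g t.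
Hypothesis g0 : g 0 = 0.
Hypothesis fN : forall t, f (- t) = - f t.
Hypothesis gN : forall t, g (- t) = g t.

Let mx t := 1%:M + f t *: X + g t *: (X *m X).

(** [fD] and [gD] are the coefficients of X and X^2 in the product of two such polynomials, reduced
    by X^3 = eps X; they make [mx] a one-parameter group. *)
Lemma cubic_flow (a : R) : is_derive (0 : R) 1 f a -> is_derive (0 : R) 1 g 0 ->
  integral_mx (mx 1) -> integral_mx (mx (-1)) ->
  exists F : flow R n, cubic_form eps F X /\ generator F (a *: X).
Proof.
move=> df dg Z1 ZN1.
have f0 : f 0 = 0.
  have := fN 0; rewrite oppr0 => /eqP; rewrite -addr_eq0 -mulr2n mulrn_eq0 /=.
  by move/eqP.
have Cmx k : Ck_mx k mx.
  move=> i j; under eq_fun do rewrite !mxE.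
  apply: CkD; first apply: CkD; first exact: (Ck_cst k setT ((i == j)%:R : R)).
    by apply: CkM => //; exact: (Ck_cst k setT (X i j)).
  by apply: CkM => //; exact: (Ck_cst k setT (\sum_l X i l * X l j)).
have mxD s t : mx (s + t) = mx s *m mx t.
  have XP : X *m (X *m X) = eps *: X by rewrite mulmxA.
  have PP : (X *m X) *m (X *m X) = eps *: (X *m X)
    by rewrite mulmxA X3 -scalemxAl.
  (* Naming X^2 keeps [mxE] from expanding it, so that [ring] treats its entries as atoms. *)
  have [P XX] : exists P, X *m X = P by eexists.
  rewrite /mx !mulmxDl !mulmxDr !mul1mx !mulmx1 -!scalemxAl -!scalemxAr.
  rewrite XP PP X3 !XX; apply/matrixP => i j; rewrite !mxE fD gD; ring.
have mx0 : mx 0 = 1%:M by rewrite /mx f0 g0 !scale0r !addr0.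
exists (Flow Cmx mxD mx0 Z1 ZN1); split=> [t|i j] /=.
  exists (f t), (g t); split=> //; first by rewrite /mx fN gN scaleNr.
  have := gD t (- t); rewrite subrr g0 fN gN => E.
  by apply/eqP; rewrite -subr_eq0 [X in _ == X]E; apply/eqP; ring.
have -> : (fun t => mx t i j) =
    cst (1%:M i j) + (X i j \*: f) + ((X *m X) i j \*: g).
  have E (A B C : 'M[R]_n) (b c : R) :
    (A + b *: B + c *: C) i j = A i j + B i j * b + C i j * c.
    by rewrite !mxE (mulrC b) (mulrC c).
  by apply/funext => t; exact: E.
have dc : is_derive (0 : R) 1 (cst ((1%:M : 'M[R]_n) i j)) (0 : R).
  exact: is_derive_cst.
have df' : is_derive (0 : R) 1 (X i j \*: f) (X i j *: a) by exact: is_deriveZ.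
have dg' : is_derive (0 : R) 1 ((X *m X) i j \*: g) ((X *m X) i j *: 0).
  exact: is_deriveZ.
apply: is_derive_eq (is_deriveD (is_deriveD dc df') dg') _.
by rewrite scaler0 addr0 add0r [RHS]mxE; exact: mulrC.
Qed.

End Cubic.
End CubicFlows.

(** * Rotations, hyperbolic flows and unipotent flows *)

Section OneParameterFlows.
Context {R : realType} {n : nat}.
Implicit Types (K M X Y Z : 'M[R]_n).

Lemma is_derive_scale (f : R -> R) (c d : R) : is_derive (0 : R) 1 f d ->
  is_derive (0 : R) 1 (fun t => f (c * t)) (c * d).
Proof.
move=> dfd.
have dg : is_derive (0 : R) 1 ( *%R c) c.
  by apply: is_derive_eq (is_deriveZ c (is_derive_id (0 : R) 1)) _;
    exact: mulr1.
have df : is_derive (c * 0) 1 f d by rewrite mulr0.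
by apply: is_derive_eq (is_derive1_comp df dg) _; exact: mulrC.
Qed.

(** Here f = sin and g = 1 - cos at 2 pi t, so the flow is the identity at integer times. *)
Lemma rotation_flow Y : Y *m Y *m Y = - Y ->
  exists F : flow R n, cubic_form (-1) F Y /\ generator F ((2 * pi) *: Y).
Proof.
move=> Y3.
have sin2 : sin (2 * pi * 1) = 0 :> R by rewrite mulr1 mulr_natl sin2pi.
have cos2 : cos (2 * pi * 1) = 1 :> R by rewrite mulr1 mulr_natl cos2pi.
apply: (@cubic_flow _ _ (-1) Y (fun t => sin (2 * pi * t))
  (fun t => 1 - cos (2 * pi * t))).
- by rewrite scaleN1r.
- by move=> k; exact/Ck_scaled/Ck_sin.
- move=> k; apply: CkD; first exact: (Ck_cst k setT (1 : R)).
  exact/CkN/Ck_scaled/Ck_cos.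
- by move=> s t; rewrite mulrDr sinD; ring.
- by move=> s t; rewrite mulrDr cosD; ring.
- by rewrite mulr0 cos0 subrr.
- by move=> t; rewrite mulrN sinN.
- by move=> t; rewrite mulrN cosN.
- have := is_derive_scale (2 * pi) (is_derive_sin 0).
  by rewrite cos0 mulr1.
- have d0 : is_derive (0 : R) 1 (cst (1 : R)) (0 : R) by exact: is_derive_cst.
  have := is_deriveB d0 (is_derive_scale (2 * pi) (is_derive_cos 0)).
  by rewrite sin0 oppr0 mulr0 subrr.
- rewrite sin2 cos2 subrr !scale0r !addr0; exact: integral1.
- rewrite mulrN sinN cosN sin2 cos2 oppr0 subrr !scale0r !addr0;
    exact: integral1.
Qed.

(* The normalized logarithm of an integral matrix M = K M with eigenvalues     *)
(* lambda and 1/lambda on the image of K: exp (ln lambda * X) = 1 - K + M.     *)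
Definition hyperbolic_mx (lambda : R) K M : 'M[R]_n :=
  (2 / (lambda - lambda^-1)) *: (M - ((lambda + lambda^-1) / 2) *: K).

Section Hyperbolic.
Variables (lambda : R) (K M : 'M[R]_n).
Hypothesis lambda_gt0 : 0 < lambda.
Hypothesis lambda_neq1 : lambda != 1.
Hypothesis trace_int : lambda + lambda^-1 \is a Num.int.
Hypotheses (K_int : integral_mx K) (M_int : integral_mx M).
Hypotheses (KK : K *m K = K) (MK : M *m K = M) (KM : K *m M = M).
Hypothesis MM : M *m M = (lambda + lambda^-1) *: M - K.

Local Notation X := (hyperbolic_mx lambda K M).

Lemma lambda_nondegenerate : (lambda != 0) && (lambda * lambda - 1 != 0).
Proof.
rewrite gt_eqF//= subr_eq0 -expr2 sqrf_eq1 (negbTE lambda_neq1) /=.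
by apply: contraTneq lambda_gt0 => ->; rewrite oppr_gt0 ltr10.
Qed.

(** By [MM], subtracting half the trace times K from M leaves a matrix whose square is ((lambda -
    1/lambda) / 2)^2 K. *)
Lemma hyperbolic_square : X *m X = K.
Proof.
rewrite /hyperbolic_mx -scalemxAl -scalemxAr scalerA.
rewrite mulmxBl !mulmxBr -!scalemxAl -!scalemxAr MM MK KM KK.
apply/matrixP => i j; rewrite !mxE; field.
exact: lambda_nondegenerate.
Qed.

(** Here f = sinh and g = cosh - 1 at t ln lambda. The values at 1 and -1 are 1 - K + M and 1 - K +
    (lambda + 1/lambda) K - M, both integral. *)
Lemma hyperbolic_flow : exists F : flow R n,
  cubic_form 1 F X /\ generator F (ln lambda *: X).
Proof.
have KX : K *m X = X by rewrite -scalemxAr mulmxBr -scalemxAr KM KK.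
have e1 : expR (ln lambda * 1) = lambda by rewrite mulr1 lnK.
have eN1 : expR (ln lambda * - 1) = lambda^-1 by rewrite mulrN expRN e1.
apply: (@cubic_flow _ _ 1 X
  (fun t => 2^-1 * expR (ln lambda * t) - 2^-1 * expR (- ln lambda * t))
  (fun t => 2^-1 * expR (ln lambda * t) + 2^-1 * expR (- ln lambda * t) - 1)).
- by rewrite hyperbolic_square KX scale1r.
- move=> k; apply: CkD; last apply: CkN.
    by apply: CkM; [exact: (Ck_cst k setT (2^-1 :
      R)) | exact/Ck_scaled/Ck_expR].
  by apply: CkM; [exact: (Ck_cst k setT (2^-1 : R)) | exact/Ck_scaled/Ck_expR].
- move=> k; apply: CkD; last exact: (Ck_cst k setT (-1 : R)).
  apply: CkD.
    by apply: CkM; [exact: (Ck_cst k setT (2^-1 :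
      R)) | exact/Ck_scaled/Ck_expR].
  by apply: CkM; [exact: (Ck_cst k setT (2^-1 : R)) | exact/Ck_scaled/Ck_expR].
- by move=> s t; rewrite !mulrDr !expRD; field.
- by move=> s t; rewrite !mulrDr !expRD; field.
- by rewrite !mulr0 expR0; field.
- by move=> t; rewrite !mulrN !mulNr opprK opprB.
- by move=> t; rewrite !mulrN !mulNr opprK (addrC (2^-1 * expR (- _))).
- have dE (c : R) : is_derive (0 :
    R) 1 (fun t => 2^-1 * expR (c * t)) (2^-1 * c).
    apply: is_derive_eq (is_deriveZ 2^-1 (is_derive_scale c (is_derive_expR
      0))) _.
    by rewrite expR0 mulr1.
  apply: is_derive_eq (is_deriveB (dE (ln lambda)) (dE (- ln lambda))) _.
  by field.
- have dE (c : R) : is_derive (0 :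
    R) 1 (fun t => 2^-1 * expR (c * t)) (2^-1 * c).
    apply: is_derive_eq (is_deriveZ 2^-1 (is_derive_scale c (is_derive_expR
      0))) _.
    by rewrite expR0 mulr1.
  have d1 : is_derive (0 : R) 1 (cst (1 : R)) (0 : R) by exact: is_derive_cst.
  apply: is_derive_eq
    (is_deriveB (is_deriveD (dE (ln lambda)) (dE (- ln lambda))) d1) _.
  by rewrite mulrN !subrr.
- rewrite !mulNr e1 expRN e1 hyperbolic_square.
  rewrite (_ : _ + _ = 1%:M + (M - K)); last first.
    by apply/matrixP => i j; rewrite !mxE; field; exact: lambda_nondegenerate.
  apply: integralD; first exact: integral1.
  by apply: integralD => //; exact: integralN.
- rewrite !mulrN !mulNr opprK expRN e1 hyperbolic_square.
  rewrite (_ : _ + _ = 1%:M + (- M + ((lambda + lambda^-1) *: K - K)));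
    last first.
    by apply/matrixP => i j; rewrite !mxE; field; exact: lambda_nondegenerate.
  apply: integralD; first exact: integral1.
  apply: integralD; first exact: integralN.
  apply: integralD; last exact: integralN.
  by move=> i j; rewrite mxE rpredM.
Qed.

End Hyperbolic.

(** For eps = 0 the addition formulas are satisfied by f = t and g = t^2/2. *)
Lemma unipotent_flow Z : integral_mx Z -> Z *m Z = 0 ->
  exists F : flow R n, cubic_form 0 F Z /\ generator F Z.
Proof.
move=> Zint ZZ.
have [F [cF gF]] : exists F : flow R n, cubic_form 0 F Z /\ generator F (1 *:
  Z).
  apply: (@cubic_flow _ _ 0 Z id (fun t => 2^-1 * (t * t))).
  - by rewrite ZZ mul0mx scale0r.
  - by move=> k; apply: Ck_lin => // x; exact: cvg_id.
  - move=> k; apply: CkM; first exact: (Ck_cst k setT (2^-1 : R)).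
    by apply: CkM; apply: Ck_lin => // x; exact: cvg_id.
  - by move=> s t; rewrite mul0r addr0.
  - by move=> s t; rewrite mul0r mul0r addr0; field.
  - by rewrite !mulr0.
  - by [].
  - by move=> t; rewrite mulrNN.
  - have did := is_derive_id (0 : R) (1 : R).
    apply: is_derive_eq (is_deriveZ 2^-1 (is_deriveM did did)) _.
    by rewrite !scale0r addr0 scaler0.
  - rewrite ZZ scaler0 addr0 scale1r; apply: integralD => //; exact: integral1.
  - rewrite ZZ scaler0 addr0 scaleN1r; apply: integralD; first exact: integral1.
    exact: integralN.
by exists F; rewrite -[Z in generator F Z]scale1r.
Qed.

End OneParameterFlows.

(** * The nine Lie algebras *)

Section Coordinates.
Context {R : realType}.

(** Rows and entries missing from the lists count as 0, which shortens the sparse matrices below. *)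
Definition entry (rows : seq (seq R)) i j : R := nth 0 (nth [::] rows i) j.

Definition mxl m n (rows : seq (seq R)) : 'M[R]_(m, n) :=
  \matrix_(i, j) entry rows i j.

Definition coef (x : 'rV[R]_6) (k : nat) : R := x 0 (inord k).

Lemma coef_ord (x : 'rV[R]_6) (i : 'I_6) : x 0 i = coef x i.
Proof. by rewrite /coef inord_val. Qed.

Lemma coefP (x y : 'rV[R]_6) :
  [/\ coef x 0 = coef y 0, coef x 1 = coef y 1 & coef x 2 = coef y 2] ->
  [/\ coef x 3 = coef y 3, coef x 4 = coef y 4 & coef x 5 = coef y 5] -> x = y.
Proof.
move=> [h0 h1 h2] [h3 h4 h5]; apply/rowP => i; rewrite !coef_ord.
by case: i => [[|[|[|[|[|[|]]]]]] ?].
Qed.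

Definition row_app (f : R -> R -> R -> R -> R -> R -> seq R) (x : 'rV[R]_6) :
    'rV[R]_6 :=
  \row_k (f (coef x 0) (coef x 1) (coef x 2) (coef x 3) (coef x 4) (coef x
    5))`_k.

Lemma coef_row_app f x k : (k < 6)%N -> coef (row_app f x) k =
  (f (coef x 0) (coef x 1) (coef x 2) (coef x 3) (coef x 4) (coef x 5))`_k.
Proof. by move=> k6; rewrite /coef mxE inordK. Qed.

Lemma coefDZ a (x y : 'rV[R]_6) k :
  coef (a *: x + y) k = a * coef x k + coef y k.
Proof. by rewrite /coef !mxE. Qed.

(** The change of basis is given by formulas in six coordinates; a left inverse f' makes its square
    matrix injective, hence invertible. *)
Lemma row_app_has_lattice (L : affine_law R 6) (eps : 6.-tuple 'M[R]_6) f f' :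
  arithmetic L -> linear (row_app f) -> (forall x, row_app f' (row_app f x) =
    x) ->
  (forall u v, row_app f (ce_bracket eps u v) =
               affine_bracket L (row_app f u) (row_app f v)) ->
  simply_connected_group_has_lattice eps.
Proof.
move=> aL lf ff' fb.
pose T : {linear 'rV[R]_6 -> 'rV[R]_6} := HB.pack (row_app f)
  (GRing.isLinear.Build _ _ _ _ _ lf).
have TE u : u *m lin1_mx T = row_app f u by rewrite mul_rV_lin1.
apply: (arithmetic_has_lattice (Q := lin1_mx T) aL) => [|u v].
  rewrite -row_free_unit -kermx_eq0; apply/eqP/row_matrixP => i.
  have rowT : row_app f (row i (kermx (lin1_mx T))) = row_app f 0.
    by rewrite -!TE mul0mx -row_mul mulmx_ker row0.
  by rewrite row0 -[LHS]ff' rowT ff'.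
by rewrite !TE.
Qed.

Lemma mxlM m n p a b i j :
  (mxl m n a *m mxl n p b) i j = \sum_(l < n) entry a i l * entry b l j.
Proof. by rewrite mxE; apply: eq_bigr => l _; rewrite !mxE. Qed.

Lemma coef_ce_bracket (eps : 6.-tuple 'M[R]_6) u v k : (k < 6)%N ->
  coef (ce_bracket eps u v) k = - eval_form (nth 0 eps k) u v.
Proof. by move=> k6; rewrite /coef mxE (tnth_nth 0) inordK. Qed.

Lemma eval_formD n (w w' : 'M[R]_n) x y :
  eval_form (w + w') x y = eval_form w x y + eval_form w' x y.
Proof. by rewrite /eval_form mulmxDr mulmxDl mxE. Qed.

Lemma eval_formN n (w : 'M[R]_n) x y : eval_form (- w) x y = - eval_form w x y.
Proof. by rewrite /eval_form mulmxN mulNmx mxE. Qed.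

Lemma eval_formZ n a (w : 'M[R]_n) x y :
  eval_form (a *: w) x y = a * eval_form w x y.
Proof. by rewrite /eval_form -scalemxAr -scalemxAl mxE. Qed.

Lemma eval_form0 n x y : eval_form (0 : 'M[R]_n) x y = 0.
Proof. by rewrite /eval_form mulmx0 mul0mx mxE. Qed.

Lemma eval_wedge i j x y : eval_form (coframe_wedge i.+1 j.+1) x y =
  coef x i * coef y j - coef x j * coef y i.
Proof.
have eval_delta (a b : 'I_6) : eval_form (delta_mx a b) x y = x 0 a * y 0 b.
  rewrite /eval_form mxE (bigD1 b)//= big1 ?addr0 => [|l lb].
    rewrite mxE (bigD1 a)//= big1 ?addr0 => [|l la].
      by rewrite !mxE !eqxx mulr1.
    by rewrite !mxE (negbTE la) mulr0.
  rewrite mxE big1 ?mul0r// => c _.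
  by rewrite !mxE (negbTE lb) andbF mulr0.
by rewrite /coframe_wedge eval_formD eval_formN !eval_delta.
Qed.

End Coordinates.

(* R^4 x| R^2, the two factors of R^2 acting through F and G.                  *)
Section AbelianByPlane.
Context {R : realType} (F G : flow R 4) (DF DG : 'M[R]_4).
Hypothesis FG : forall s t, flow_mx F s *m flow_mx G t =
  flow_mx G t *m flow_mx F s.
Hypotheses (FD : generator F DF) (GD : generator G DG).

Definition plane_law : affine_law R (4 + 1 + 1) :=
  extension (stabilized_equivariant FG).

Lemma plane_arithmetic : arithmetic plane_law.
Proof. by do 2!apply: extension_arithmetic; exact: abelian_arithmetic. Qed.

Lemma plane_bracket_row (x y : 'rV[R]_(4 + 1 + 1)) :
  affine_bracket plane_law x y =
  row_mx (row_mx (coef x 4 *: (lsubmx (lsubmx y) *m DF)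
                  - coef y 4 *: (lsubmx (lsubmx x) *m DF)
                  + (coef x 5 *: (lsubmx (lsubmx y) *m DG)
                     - coef y 5 *: (lsubmx (lsubmx x) *m DG))) 0) 0.
Proof.
have t5 (z : 'rV[R]_(4 + 1 + 1)) : rsubmx z 0 0 = coef z 5.
  by rewrite mxE coef_ord.
have t4 (z : 'rV[R]_(4 + 1 + 1)) : rsubmx (lsubmx z) 0 0 = coef z 4.
  by rewrite !mxE coef_ord.
rewrite (extension_bracket _ (stabilized_generator GD)).
rewrite (extension_bracket _ FD) abelian_bracket !t4 !t5.
rewrite -[X in X *m block_mx DG _ _ _]hsubmxK.
rewrite -[X in _ - _ *: (X *m block_mx DG _ _ _)]hsubmxK.
rewrite !mul_row_block !mulmx0 !addr0 !scale_row_mx.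
rewrite opp_row_mx !add_row_mx !scaler0 subrr add0r addr0.
by [].
Qed.

Lemma plane_bracketE x y k : (k < 4)%N ->
  coef (affine_bracket plane_law x y) k =
  \sum_(l < 4) ((coef x 4 * coef y l - coef y 4 * coef x l) * DF l (inord k) +
                (coef x 5 * coef y l - coef y 5 * coef x l) * DG l (inord k)).
Proof.
move=> k4.
have -> : coef (affine_bracket plane_law x y) k =
    (affine_bracket plane_law x y) 0 (lshift 1 (lshift 1 (inord k))).
  by rewrite coef_ord /= inordK.
have lin (a b c d : R) (A B C D : 'rV[R]_4) j :
    (a *: A - b *: B + (c *: C - d *: D)) 0 j =
    a * A 0 j - b * B 0 j + (c * C 0 j - d * D 0 j) by rewrite !mxE.
have E D (z : 'rV[R]_(4 + 1 + 1)) j :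
    (lsubmx (lsubmx z) *m D) 0 j = \sum_(l < 4) coef z l * D l j.
  by rewrite mxE; apply: eq_bigr => l _; rewrite !mxE coef_ord.
rewrite plane_bracket_row !row_mxEl lin !E !mulr_sumr -!sumrB -big_split /=.
by apply: eq_bigr => l _; ring.
Qed.

Lemma plane_bracket4 x y : coef (affine_bracket plane_law x y) 4 = 0.
Proof.
have -> : coef (affine_bracket plane_law x y) 4 =
    (affine_bracket plane_law x y) 0 (lshift 1 (rshift 4 0)).
  by rewrite coef_ord.
by rewrite plane_bracket_row row_mxEl row_mxEr mxE.
Qed.

Lemma plane_bracket5 x y : coef (affine_bracket plane_law x y) 5 = 0.
Proof.
have -> : coef (affine_bracket plane_law x y) 5 =
    (affine_bracket plane_law x y) 0 (rshift 5 0).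
  by rewrite coef_ord.
by rewrite plane_bracket_row row_mxEr mxE.
Qed.

End AbelianByPlane.

Lemma plane_bracket_mxl (R : realType) (F G : flow R 4) f g
    (FG : forall s t, flow_mx F s *m flow_mx G t = flow_mx G t *m flow_mx F s) :
  generator F (mxl 4 4 f) -> generator G (mxl 4 4 g) ->
    forall x y k, (k < 4)%N ->
  coef (affine_bracket (plane_law FG) x y) k =
  (coef x 4 * coef y 0 - coef y 4 * coef x 0) * entry f 0 k +
  (coef x 4 * coef y 1 - coef y 4 * coef x 1) * entry f 1 k +
  (coef x 4 * coef y 2 - coef y 4 * coef x 2) * entry f 2 k +
  (coef x 4 * coef y 3 - coef y 4 * coef x 3) * entry f 3 k +
  ((coef x 5 * coef y 0 - coef y 5 * coef x 0) * entry g 0 k +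
   (coef x 5 * coef y 1 - coef y 5 * coef x 1) * entry g 1 k +
   (coef x 5 * coef y 2 - coef y 5 * coef x 2) * entry g 2 k +
   (coef x 5 * coef y 3 - coef y 5 * coef x 3) * entry g 3 k).
Proof.
move=> Ff Gg x y k k4; rewrite (plane_bracketE _ Ff Gg)//.
by rewrite !big_ord_recl big_ord0 !mxE inordK//= addr0; ring.
Qed.

Section Lambda.
Context {R : realType}.

(* The largest root of x + 1/x = N.                                            *)
Definition lambda_of (N : nat) : R := (N%:R + Num.sqrt (N%:R ^+ 2 - 4)) / 2.

Lemma lambda_trace N : (2 <= N)%N -> lambda_of N + (lambda_of N)^-1 = N%:R.
Proof.
move=> N2; have N2' : 2 <= N%:R :> R by rewrite ler_nat.
have d0 : 0 <= N%:R ^+ 2 - 4 :> R by nra.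
have s2 := sqr_sqrtr d0; have s0 := sqrtr_ge0 (N%:R ^+ 2 - 4 : R).
have l0 : lambda_of N != 0 by rewrite /lambda_of gt_eqF//; lra.
apply: (mulIf l0); rewrite mulrDl mulVf// /lambda_of.
move: s2; set s := Num.sqrt _; rewrite !expr2 => s2; nra.
Qed.

Lemma lambda_gt1 N : (2 < N)%N -> 1 < lambda_of N.
Proof.
move=> N2; have N2' : 2 < N%:R :> R by rewrite ltr_nat.
have s0 := sqrtr_ge0 (N%:R ^+ 2 - 4 : R).
by rewrite /lambda_of; lra.
Qed.

End Lambda.

Ltac case_ordinals :=
  case => [[|[|[|[|[|[|?]]]]]] // ?]; case => [[|[|[|[|[|[|?]]]]]] // ?].

Ltac check_linear :=
  move=> a0 u v; apply: coefP; split; rewrite coefDZ !coef_row_app//= !coefDZ;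
    ring.

(** * The algebras with abelian ideal R^4: g_1, g_2, g_3, g_8 *)

Section PlaneAlgebras.
Context {R : realType}.
Variable lambda : R.
Hypothesis lambda_gt1 : 1 < lambda.
(* [simpl] would unfold [pi] in [2 * pi].                                      *)
Variable tau : R.
Hypothesis tauE : tau = 2 * pi.
Hypothesis trace_int : lambda + lambda^-1 \is a Num.int.

Let lambda_gt0 : 0 < lambda. Proof. exact: lt_trans lambda_gt1. Qed.
Let lambda_neq1 : lambda != 1. Proof. by rewrite gt_eqF. Qed.
Let ln_neq0 : ln lambda != 0. Proof. by rewrite gt_eqF// ln_gt0. Qed.
Let lambda_neq0 : lambda != 0. Proof. by rewrite gt_eqF. Qed.
Let lambda_sq : lambda * lambda - 1 != 0.
Proof. by case/andP: (lambda_nondegenerate lambda_gt0 lambda_neq1). Qed.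
Let tau_neq0 : tau != 0. Proof.
  by rewrite tauE mulf_neq0// gt_eqF// pi_gt0. Qed.
Ltac field_nz := field; rewrite ?lambda_neq0 ?lambda_sq ?ln_neq0 ?tau_neq0//.
Ltac check_inverse :=
  move=> x; apply: coefP; split; rewrite coef_row_app//= !coef_row_app//=;
    field_nz.
Ltac check_plane_bracket FD GD :=
  move=> u v; apply: coefP; split; rewrite coef_row_app//=
    ?(plane_bracket4 _ FD GD) ?(plane_bracket5 _ FD GD)
    ?(plane_bracket_mxl _ FD GD)//= !coef_ce_bracket//=
    ?(eval_wedge, eval_form0, eval_formN, eval_formZ, eval_formD)
    ?coef_row_app//= /entry /=;
  field_nz.

Definition cat_mx : 'M[R]_4 := mxl 4 4
  [:: [:: 0; 1; 0; 0]; [:: -1; lambda + lambda^-1; 0; 0];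
      [:: 0; 0; 0; 1]; [:: 0; 0; -1; lambda + lambda^-1]].

Lemma cat_mx_int : integral_mx cat_mx.
Proof.
move=> i j; rewrite mxE.
case: i => [[|[|[|[|//]]]] ?]; case: j => [[|[|[|[|//]]]] ?];
  by rewrite /entry /= ?rpredN ?rpred0 ?rpred1.
Qed.

Lemma cat_mx_square : cat_mx *m cat_mx = (lambda + lambda^-1) *: cat_mx - 1%:M.
Proof.
apply/matrixP => i j; rewrite mxlM !mxE !big_ord_recl big_ord0.
case: i => [[|[|[|[|//]]]] ?]; case: j => [[|[|[|[|//]]]] ?];
  rewrite /entry /= ; ring.
Qed.

Definition cat_log : seq (seq R) :=
  let c := ln lambda * 2 / (lambda - lambda^-1) in
  let h := (lambda + lambda^-1) / 2 in
  [:: [:: - c * h; c; 0; 0]; [:: - c; c * h; 0; 0];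
      [:: 0; 0; - c * h; c]; [:: 0; 0; - c; c * h]].

Lemma cat_logE : ln lambda *: hyperbolic_mx lambda 1%:M cat_mx =
  mxl 4 4 cat_log.
Proof.
apply/matrixP => i j; rewrite !mxE.
case: i => [[|[|[|[|//]]]] ?]; case: j => [[|[|[|[|//]]]] ?];
  rewrite /entry /= ; field; by rewrite ?lambda_neq0 ?lambda_sq.
Qed.

Lemma cat_flow : exists F : flow R 4, cubic_form 1 F (hyperbolic_mx lambda 1%:M
  cat_mx)
  /\ generator F (mxl 4 4 cat_log).
Proof.
rewrite -cat_logE; apply: hyperbolic_flow => //; rewrite ?mulmx1 ?mul1mx//.
- exact: integral1.
- exact: cat_mx_int.
- exact: cat_mx_square.
Qed.

Lemma zero_generator : generator (trivial_flow 4) (mxl 4 4 ([::] :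
  seq (seq R))).
Proof.
rewrite (_ : mxl _ _ _ = 0); first exact: trivial_generator.
by apply/matrixP => i j; rewrite !mxE /entry !nth_nil.
Qed.

(* (1, - lambda) and (1, - 1/lambda) are the left eigenvectors of the blocks   *)
(* of [cat_mx]; the basis e_1, ..., e_4 is mapped to copies of these.          *)
Lemma g1_lattice : simply_connected_group_has_lattice (g1 (R := R)).
Proof.
have [F [_ FD]] := cat_flow.
have FG s t : flow_mx F s *m flow_mx (trivial_flow 4) t =
              flow_mx (trivial_flow 4) t *m flow_mx F s.
  by rewrite mulmx1 mul1mx.
have GD := zero_generator.
pose d := lambda - lambda^-1.
apply: (@row_app_has_lattice R (plane_law FG) _
  (fun a b c d t s => [:: a + b; - lambda * a - lambda^-1 * b;
     c + d; - lambda^-1 * c - lambda * d; (ln lambda)^-1 * t; s])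
  (fun p q p' q' t s => [:: - (lambda^-1 * p + q) / d; (lambda * p + q) / d;
     (lambda * p' + q') / d; - (lambda^-1 * p' + q') / d; ln lambda * t; s])).
- exact: plane_arithmetic.
- check_linear.
- rewrite /d; check_inverse.
- check_plane_bracket FD GD.
Qed.

Definition turn_list : seq (seq R) :=
  [:: [:: 0; 0; -1; 0]; [:: 0; 0; 0; -1]; [:: 1; 0; 0; 0]; [:: 0; 1; 0; 0]].

Lemma turn_cube : mxl 4 4 turn_list *m mxl 4 4 turn_list *m mxl 4 4 turn_list =
  - mxl 4 4 turn_list.
Proof.
have -> : mxl 4 4 turn_list *m mxl 4 4 turn_list = - 1%:M.
  apply/matrixP; case_ordinals;
    by rewrite mxlM !mxE !big_ord_recl big_ord0 /entry /=; ring.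
by rewrite mulNmx mul1mx.
Qed.

Definition log_turn_list : seq (seq R) :=
  [:: [:: 0; 0; - tau; 0]; [:: 0; 0; 0; - tau];
      [:: tau; 0; 0; 0]; [:: 0; tau; 0; 0]].

Lemma turn_flow : exists F : flow R 4,
  cubic_form (-1) F (mxl 4 4 turn_list) /\ generator F (mxl 4 4 log_turn_list).
Proof.
have -> : mxl 4 4 log_turn_list = tau *: mxl 4 4 turn_list.
  by apply/matrixP; case_ordinals; rewrite !mxE /entry /=; ring.
by rewrite tauE; exact/rotation_flow/turn_cube.
Qed.

(** [cat_mx] acts in the same way on two copies of R^2, and the rotation exchanges these copies up
    to sign. *)
Lemma turn_cat_comm : comm_mx (mxl 4 4 turn_list) (hyperbolic_mx lambda 1%:M
  cat_mx).
Proof.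
apply/comm_mxZ/comm_mxB; last by apply/comm_mxZ/comm_mx1.
by apply/matrixP; case_ordinals;
  rewrite !mxlM !big_ord_recl !big_ord0 /entry /=; ring.
Qed.

(** The rotation preserves each of the two eigenplanes of [cat_mx]. There the product flow has
    generator ln lambda or - ln lambda plus a rotation of speed tau; dividing time by tau leaves
    alpha = ln lambda / tau and unit rotation. *)
Lemma g2_lattice : simply_connected_group_has_lattice (g2 (ln lambda / tau)).
Proof.
have [H [cH HD]] := cat_flow; have [T [cT TD]] := turn_flow.
have HT s t : flow_mx H s *m flow_mx T t = flow_mx T t *m flow_mx H s.
  apply/esym/(cubic_form_comm _ cH)/comm_mx_sym/(cubic_form_comm _ cT).
  exact/comm_mx_sym/turn_cat_comm.
pose F := product_flow HT.
pose c : R := ln lambda * 2 / (lambda - lambda^-1).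
pose h : R := (lambda + lambda^-1) / 2.
have FD : generator F (mxl 4 4
  [:: [:: - c * h; c; - tau]; [:: - c; c * h; 0; - tau];
      [:: tau; 0; - c * h; c]; [:: 0; tau; - c; c * h]]).
  have := product_generator HT HD TD; congr generator.
  by apply/matrixP; case_ordinals; rewrite !mxE /entry /= /c /h; ring.
have FG s t : flow_mx F s *m flow_mx (trivial_flow 4) t =
              flow_mx (trivial_flow 4) t *m flow_mx F s.
  by rewrite mulmx1 mul1mx.
have GD := zero_generator.
pose d := lambda - lambda^-1.
apply: (@row_app_has_lattice R (plane_law FG) _
  (fun a b c d t s => [:: a + c; - lambda * a - lambda^-1 * c;
     b + d; - lambda * b - lambda^-1 * d; tau^-1 * t; s])
  (fun p q p' q' t s => [:: - (lambda^-1 * p + q) / d;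
    - (lambda^-1 * p' + q') / d;
     (lambda * p + q) / d; (lambda * p' + q') / d; tau * t; s])).
- exact: plane_arithmetic.
- check_linear.
- rewrite /d; check_inverse.
- rewrite /c /h in FD; check_plane_bracket FD GD.
Qed.

(** Here e_5 acts by the rotation and e_6 by the hyperbolic flow. As e_5 turns the planes of e_1,
    e_2 and of e_3, e_4 in opposite senses, e_2 is sent to the opposite of an eigenvector copy. *)
Lemma g8_lattice : simply_connected_group_has_lattice (g8 (R := R)).
Proof.
have [H [cH HD]] := cat_flow; have [T [cT TD]] := turn_flow.
have TH s t : flow_mx T s *m flow_mx H t = flow_mx H t *m flow_mx T s.
  apply/(cubic_form_comm _ cH)/comm_mx_sym/(cubic_form_comm _ cT).
  exact/comm_mx_sym/turn_cat_comm.
pose d := lambda - lambda^-1.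
apply: (@row_app_has_lattice R (plane_law TH) _
  (fun a b c d s t => [:: a + c; - lambda * a - lambda^-1 * c;
     d - b; lambda * b - lambda^-1 * d; tau^-1 * s; (ln lambda)^-1 * t])
  (fun p q p' q' s t => [:: - (lambda^-1 * p + q) / d;
    (lambda^-1 * p' + q') / d;
     (lambda * p + q) / d; (lambda * p' + q') / d; tau * s; ln lambda * t])).
- exact: plane_arithmetic.
- check_linear.
- rewrite /d; check_inverse.
- check_plane_bracket TD HD.
Qed.

Definition half_cat_mx : 'M[R]_4 := mxl 4 4
  [:: [::]; [::]; [:: 0; 0; 0; 1]; [:: 0; 0; -1; lambda + lambda^-1]].

Definition half_proj : 'M[R]_4 := mxl 4 4
  [:: [::]; [::]; [:: 0; 0; 1; 0]; [:: 0; 0; 0; 1]].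

Definition half_cat_log : seq (seq R) :=
  let c := ln lambda * 2 / (lambda - lambda^-1) in
  let h := (lambda + lambda^-1) / 2 in
  [:: [::]; [::]; [:: 0; 0; - c * h; c]; [:: 0; 0; - c; c * h]].

Lemma half_cat_flow : exists F : flow R 4,
  cubic_form 1 F (hyperbolic_mx lambda half_proj half_cat_mx) /\
  generator F (mxl 4 4 half_cat_log).
Proof.
have -> : mxl 4 4 half_cat_log =
    ln lambda *: hyperbolic_mx lambda half_proj half_cat_mx.
  by apply/matrixP; case_ordinals; rewrite !mxE /entry /=; field_nz.
apply: hyperbolic_flow => //.
- by case_ordinals; rewrite mxE /entry /= ?rpred0 ?rpred1.
- by case_ordinals; rewrite mxE /entry /= ?rpredN ?rpred0 ?rpred1.
all: apply/matrixP; case_ordinals;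
  rewrite mxlM ?mxE !big_ord_recl big_ord0 ?mxE /entry /=; ring.
Qed.

Definition half_turn_list : seq (seq R) := [:: [:: 0; -1; 0; 0]; [:: 1; 0; 0;
  0]].

Lemma half_turn_flow : exists F : flow R 4,
  cubic_form (-1) F (mxl 4 4 half_turn_list) /\
  generator F (mxl 4 4 [:: [:: 0; - tau; 0; 0]; [:: tau; 0; 0; 0]]).
Proof.
rewrite (_ : mxl 4 4 [:: [:: 0; - tau; 0; 0];
  _] = tau *: mxl 4 4 half_turn_list).
  rewrite tauE; apply: rotation_flow.
  have -> : mxl 4 4 half_turn_list *m mxl 4 4 half_turn_list =
      mxl 4 4 [:: [:: -1; 0; 0; 0]; [:: 0; -1; 0; 0]].
    by apply/matrixP; case_ordinals;
      rewrite mxlM mxE !big_ord_recl big_ord0 /entry /=; ring.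
  by apply/matrixP; case_ordinals;
    rewrite mxlM !mxE !big_ord_recl big_ord0 /entry /=; ring.
by apply/matrixP; case_ordinals; rewrite !mxE /entry /=; ring.
Qed.

Lemma half_turn_cat_comm :
  comm_mx (mxl 4 4 half_turn_list) (hyperbolic_mx lambda half_proj half_cat_mx).
Proof.
apply/comm_mxZ/comm_mxB; last apply/comm_mxZ.
all: by apply/matrixP; case_ordinals;
  rewrite !mxlM !big_ord_recl !big_ord0 /entry /=; ring.
Qed.

(** The algebra is a product: e_1 rotates the plane of e_2, e_3, and e_4 exchanges e_5 and e_6. The
    eigenvectors e_5 + e_6 and e_5 - e_6 go to 2 (1, - lambda) and 2 (1, - 1/lambda). *)
Lemma g3_lattice : simply_connected_group_has_lattice (g3 (R := R)).
Proof.
have [H [cH HD]] := half_cat_flow; have [T [cT TD]] := half_turn_flow.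
have TH s t : flow_mx T s *m flow_mx H t = flow_mx H t *m flow_mx T s.
  apply/(cubic_form_comm _ cH)/comm_mx_sym/(cubic_form_comm _ cT).
  exact/comm_mx_sym/half_turn_cat_comm.
pose d := lambda - lambda^-1.
apply: (@row_app_has_lattice R (plane_law TH) _
  (fun s a b t p q => [:: a; b; 2 * p;
     - lambda * (p + q) - lambda^-1 * (p - q); tau^-1 * s; (ln lambda)^-1 * t])
  (fun a b x y s t => [:: tau * s; a; b; ln lambda * t; x / 2;
     - (y + (lambda + lambda^-1) * (x / 2)) / d])).
- exact: plane_arithmetic.
- check_linear.
- rewrite /d; check_inverse.
- check_plane_bracket TD HD.
Qed.

Lemma g2_0_lattice : simply_connected_group_has_lattice (g2 (0 : R)).
Proof.
have [T [_ TD]] := turn_flow.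
have TG s t : flow_mx T s *m flow_mx (trivial_flow 4) t =
              flow_mx (trivial_flow 4) t *m flow_mx T s.
  by rewrite mulmx1 mul1mx.
have GD := zero_generator.
apply: (@row_app_has_lattice R (plane_law TG) _
  (fun a b c d t s => [:: a; c; b; d; tau^-1 * t; s])
  (fun a c b d t s => [:: a; b; c; d; tau * t; s])).
- exact: plane_arithmetic.
- check_linear.
- check_inverse.
- check_plane_bracket TD GD.
Qed.

End PlaneAlgebras.

(** * Heisenberg groups extended by a line *)

Section HeisenbergByLine.
Context {R : realType} (eps : R) (F : flow R 5) (X : 'M[R]_5) (w f :
  seq (seq R)).
Local Notation W := (mxl 5 5 w).
Hypothesis WT : W^T = - W.
Hypothesis W0 : (delta_mx 0 0 : 'rV[R]_5) *m W = 0.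
Hypothesis W_int : integral_mx W.
Hypothesis XF : cubic_form eps F X.
Hypothesis XW : X *m W = - (W *m X^T).
Hypothesis X0 : (delta_mx 0 0 : 'rV[R]_5) *m X = 0.
Hypothesis FD : generator F (mxl 5 5 f).

Let flow_equivariant : equivariant (heis_law WT W0) F.
Proof.
apply: heis_equivariant => t; first exact: (cubic_form_form _ XF).
exact: (cubic_form_row _ XF).
Qed.

Definition heis_ext : affine_law R (5 + 1) := extension flow_equivariant.

Lemma heis_ext_arithmetic : arithmetic heis_ext.
Proof. by apply: extension_arithmetic; exact: heis_arithmetic. Qed.

Lemma heis_ext_bracketE (x y : 'rV[R]_(5 + 1)) k : (k < 5)%N ->
  coef (affine_bracket heis_ext x y) k =
  (\sum_(j < 5) (\sum_(i < 5) coef x i * entry w i j) * coef y j) *+ 2 * (k ==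
    0)%:R +
  \sum_(l < 5) (coef x 5 * coef y l - coef y 5 * coef x l) * entry f l k.
Proof.
move=> k5.
have -> : coef (affine_bracket heis_ext x y) k =
    (affine_bracket heis_ext x y) 0 (lshift 1 (inord k)).
  by rewrite coef_ord /= inordK.
have t5 (z : 'rV[R]_(5 + 1)) : rsubmx z 0 0 = coef z 5.
  by rewrite mxE coef_ord.
rewrite (extension_bracket _ FD) row_mxEl heis_bracket !t5.
have cE (z : 'rV[R]_(5 + 1)) (l : 'I_5) : lsubmx z 0 l = coef z l.
  by rewrite mxE coef_ord.
have -> : (lsubmx x *m W *m (lsubmx y)^T) 0 0 =
    \sum_(j < 5) (\sum_(i < 5) coef x i * entry w i j) * coef y j.
  rewrite mxE; apply: eq_bigr => j _; rewrite mxE [_^T _ _]mxE cE;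
    congr (_ * _).
  by apply: eq_bigr => i _; rewrite cE mxE.
have E (z : 'rV[R]_(5 + 1)) : (lsubmx z *m mxl 5 5 f) 0 (inord k) =
    \sum_(l < 5) coef z l * entry f l k.
  by rewrite mxE; apply: eq_bigr => l _; rewrite cE mxE inordK.
have lin (a b c : R) (A B C : 'rV[R]_5) j :
    (a *: A + (b *: B - c *: C)) 0 j = a * A 0 j + (b * B 0 j - c * C 0 j).
  by rewrite !mxE.
rewrite lin !E !mulr_sumr -!sumrB; congr (_ * _ + _).
  by rewrite mxE eqxx -val_eqE /= inordK.
by apply: eq_bigr => l _; ring.
Qed.

Lemma heis_ext_bracket5 (x y : 'rV[R]_(5 + 1)) :
  coef (affine_bracket heis_ext x y) 5 = 0.
Proof.
have -> : coef (affine_bracket heis_ext x y) 5 =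
    (affine_bracket heis_ext x y) 0 (rshift 5 0).
  by rewrite coef_ord.
by rewrite (extension_bracket _ FD) row_mxEr mxE.
Qed.

End HeisenbergByLine.

(** * The algebras with Heisenberg ideal: g_4, g_5, g_6, g_7 *)

Section HeisenbergAlgebras.
Context {R : realType}.
Variables lambda tau : R.
Hypothesis lambda_gt1 : 1 < lambda.
Hypothesis tauE : tau = 2 * pi.
Hypothesis trace_int : lambda + lambda^-1 \is a Num.int.

Let lambda_gt0 : 0 < lambda. Proof. exact: lt_trans lambda_gt1. Qed.
Let lambda_neq1 : lambda != 1. Proof. by rewrite gt_eqF. Qed.
Let ln_neq0 : ln lambda != 0. Proof. by rewrite gt_eqF// ln_gt0. Qed.
Let lambda_neq0 : lambda != 0. Proof. by rewrite gt_eqF. Qed.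
Let lambda_sq : lambda * lambda - 1 != 0.
Proof. by case/andP: (lambda_nondegenerate lambda_gt0 lambda_neq1). Qed.
Let tau_neq0 : tau != 0. Proof.
  by rewrite tauE mulf_neq0// gt_eqF// pi_gt0. Qed.

Ltac field_nz := field; rewrite ?lambda_neq0 ?lambda_sq ?ln_neq0 ?tau_neq0//.
Ltac check_inverse :=
  move=> x; apply: coefP; split; rewrite coef_row_app//= !coef_row_app//=;
    field_nz.
Ltac check_entries :=
  apply/matrixP; case_ordinals;
  rewrite !mxE ?big_ord_recl ?big_ord0 ?mxE /entry /=; field_nz.
Ltac check_row :=
  apply/rowP; case=> [[|[|[|[|[|?]]]]] // ?];
  rewrite !mxE ?big_ord_recl ?big_ord0 ?mxE /entry /=; field_nz.
Ltac check_heis_bracket FD :=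
  move=> u v; apply: coefP; split; rewrite coef_row_app//=
    ?(heis_ext_bracket5 _ _ _ _ _ FD) ?(heis_ext_bracketE _ _ _ _ _ FD)//=
    ?big_ord_recl ?big_ord0 !coef_ce_bracket//=
    ?(eval_wedge, eval_form0, eval_formN, eval_formZ, eval_formD)
    ?coef_row_app//= /entry /=;
  field_nz.

Definition cross_form : seq (seq R) :=
  [:: [::]; [:: 0; 0; 0; 1; 0]; [:: 0; 0; 0; 0; 1];
      [:: 0; -1; 0; 0; 0]; [:: 0; 0; -1; 0; 0]].

Definition paired_turn (t : R) : seq (seq R) :=
  [:: [::]; [:: 0; 0; t; 0; 0]; [:: 0; - t; 0; 0; 0];
      [:: 0; 0; 0; 0; t]; [:: 0; 0; 0; - t; 0]].

Lemma cube_of_turn (X : 'M[R]_5) (K : 'M[R]_5) :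
  X *m X = - K -> K *m X = X -> X *m X *m X = - X.
Proof. by move=> -> KX; rewrite mulNmx KX. Qed.

Definition heis_proj : 'M[R]_5 :=
  mxl 5 5 [:: [::]; [:: 0; 1]; [:: 0; 0; 1]; [:: 0; 0; 0; 1]; [:: 0; 0; 0; 0;
    1]].

Lemma paired_turn_flow : exists F : flow R 5,
  cubic_form (-1) F (mxl 5 5 (paired_turn 1)) /\
  generator F (mxl 5 5 (paired_turn tau)).
Proof.
have -> : mxl 5 5 (paired_turn tau) = tau *: mxl 5 5 (paired_turn 1)
  by check_entries.
rewrite tauE; apply: rotation_flow.
apply: (@cube_of_turn _ heis_proj); check_entries.
Qed.

Lemma cross_formT : (mxl 5 5 cross_form)^T = - mxl 5 5 cross_form.
Proof. check_entries. Qed.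

Lemma cross_form0 : (delta_mx 0 0 : 'rV[R]_5) *m mxl 5 5 cross_form = 0.
Proof. check_row. Qed.

Lemma cross_form_int : integral_mx (mxl 5 5 cross_form).
Proof. by case_ordinals; rewrite mxE /entry /= ?rpredN ?rpred0 ?rpred1. Qed.

Lemma paired_turn0 : (delta_mx 0 0 : 'rV[R]_5) *m mxl 5 5 (paired_turn 1) = 0.
Proof. check_row. Qed.

Lemma g6_lattice : simply_connected_group_has_lattice (g6 (R := R)).
Proof.
have [F [cF FD]] := paired_turn_flow.
have XW : mxl 5 5 (paired_turn 1) *m mxl 5 5 cross_form =
    - (mxl 5 5 cross_form *m (mxl 5 5 (paired_turn 1))^T) by check_entries.
(* The central coordinate is scaled by -2: the factor 2 comes from [heis_bracket], the sign from
   [ce_bracket]. *)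
apply: (@row_app_has_lattice R (heis_ext cross_formT cross_form0 cF XW
  paired_turn0) _
  (fun z a b c d t => [:: -2 * z; a; b; c; d; tau^-1 * t])
  (fun z a b c d t => [:: -2^-1 * z; a; b; c; d; tau * t])).
- exact/heis_ext_arithmetic/cross_form_int.
- check_linear.
- check_inverse.
- check_heis_bracket FD.
Qed.

(** For b = 0 the group is the three-dimensional Heisenberg group times R^2, as in g_4; for b = 1 it
    is the five-dimensional one, as in g_5. *)
Definition area_form (b : R) : seq (seq R) :=
  [:: [::]; [:: 0; 0; 1; 0; 0]; [:: 0; -1; 0; 0; 0];
      [:: 0; 0; 0; 0; b]; [:: 0; 0; 0; - b; 0]].

Lemma area_formT b : (mxl 5 5 (area_form b))^T = - mxl 5 5 (area_form b).
Proof. check_entries. Qed.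

Lemma area_form0 b : (delta_mx 0 0 : 'rV[R]_5) *m mxl 5 5 (area_form b) = 0.
Proof. check_row. Qed.

Lemma area_form_int b : b \is a Num.int -> integral_mx (mxl 5 5 (area_form b)).
Proof.
by move=> bZ; case_ordinals; rewrite mxE /entry /= ?rpredN ?rpred0 ?rpred1.
Qed.

Lemma g4_lattice : simply_connected_group_has_lattice (g4 (R := R)).
Proof.
have [F [cF FD]] := paired_turn_flow.
have XW : mxl 5 5 (paired_turn 1) *m mxl 5 5 (area_form 0) =
    - (mxl 5 5 (area_form 0) *m (mxl 5 5 (paired_turn 1))^T) by check_entries.
apply: (@row_app_has_lattice R
  (heis_ext (area_formT 0) (area_form0 0) cF XW paired_turn0) _
  (fun z a b c d t => [:: -2 * z; a; b; c; d; tau^-1 * t])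
  (fun z a b c d t => [:: -2^-1 * z; a; b; c; d; tau * t])).
- exact/heis_ext_arithmetic/area_form_int/rpred0.
- check_linear.
- check_inverse.
- check_heis_bracket FD.
Qed.

Definition crossed_turn (t : R) : seq (seq R) :=
  [:: [::]; [:: 0; 0; 0; - t; 0]; [:: 0; 0; 0; 0; - t];
      [:: 0; t; 0; 0; 0]; [:: 0; 0; t; 0; 0]].

Lemma crossed_turn_flow : exists F : flow R 5,
  cubic_form (-1) F (mxl 5 5 (crossed_turn 1)) /\
  generator F (mxl 5 5 (crossed_turn tau)).
Proof.
have -> : mxl 5 5 (crossed_turn tau) = tau *: mxl 5 5 (crossed_turn 1).
  by check_entries.
rewrite tauE; apply: rotation_flow.
apply: (@cube_of_turn _ heis_proj); check_entries.
Qed.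

Lemma g7_lattice : simply_connected_group_has_lattice (g7 (R := R)).
Proof.
have [F [cF FD]] := crossed_turn_flow.
have XW : mxl 5 5 (crossed_turn 1) *m mxl 5 5 cross_form =
    - (mxl 5 5 cross_form *m (mxl 5 5 (crossed_turn 1))^T) by check_entries.
have X0 : (delta_mx 0 0 : 'rV[R]_5) *m mxl 5 5 (crossed_turn 1) = 0
  by check_row.
apply: (@row_app_has_lattice R (heis_ext cross_formT cross_form0 cF XW X0) _
  (fun z a b c d t => [:: -2 * z; a; b; c; d; tau^-1 * t])
  (fun z a b c d t => [:: -2^-1 * z; a; b; c; d; tau * t])).
- exact/heis_ext_arithmetic/cross_form_int.
- check_linear.
- check_inverse.
- check_heis_bracket FD.
Qed.

Definition heis_cat_mx : 'M[R]_5 := mxl 5 5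
  [:: [::]; [:: 0; 0; 1; 0; 0]; [:: 0; -1; lambda + lambda^-1; 0; 0];
      [:: 0; 0; 0; 0; 1]; [:: 0; 0; 0; -1; lambda + lambda^-1]].

Definition heis_cat_log (c : R) : seq (seq R) :=
  let k := c * (2 / (lambda - lambda^-1)) in
  let h := (lambda + lambda^-1) / 2 in
  [:: [::]; [:: 0; - k * h; k; 0; 0]; [:: 0; - k; k * h; 0; 0];
      [:: 0; 0; 0; - k * h; k]; [:: 0; 0; 0; - k; k * h]].

Lemma heis_cat_logE c :
  c *: hyperbolic_mx lambda heis_proj heis_cat_mx = mxl 5 5 (heis_cat_log c).
Proof. check_entries. Qed.

Lemma heis_cat_flow : exists F : flow R 5,
  cubic_form 1 F (mxl 5 5 (heis_cat_log 1)) /\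
  generator F (mxl 5 5 (heis_cat_log (ln lambda))).
Proof.
rewrite -!heis_cat_logE scale1r; apply: hyperbolic_flow => //.
- by case_ordinals; rewrite mxE /entry /= ?rpred0 ?rpred1.
- by case_ordinals; rewrite mxE /entry /= ?rpredN ?rpred0 ?rpred1.
all: check_entries.
Qed.

(** The blocks of the generator have trace zero, so they preserve area. The eigenvectors (1, -
    lambda) and (1, - 1/lambda) span the area d, hence the extra factor d on the central
    coordinate. *)
Lemma g5_lattice : simply_connected_group_has_lattice (g5 (R := R)).
Proof.
have [F [cF FD]] := heis_cat_flow.
have XW : mxl 5 5 (heis_cat_log 1) *m mxl 5 5 (area_form 1) =
    - (mxl 5 5 (area_form 1) *m (mxl 5 5 (heis_cat_log 1))^T) by check_entries.
have X0 : (delta_mx 0 0 : 'rV[R]_5) *m mxl 5 5 (heis_cat_log 1) = 0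
  by check_row.
pose d := lambda - lambda^-1.
apply: (@row_app_has_lattice R (heis_ext (area_formT 1) (area_form0 1) cF XW
  X0) _
  (fun z a b c e t => [:: -2 * d * z; a + c; - lambda * a - lambda^-1 * c;
     b + e; - lambda * b - lambda^-1 * e; (ln lambda)^-1 * t])
  (fun z p q p' q' t => [:: -2^-1 / d * z; - (lambda^-1 * p + q) / d;
     - (lambda^-1 * p' + q') / d; (lambda * p + q) / d; (lambda * p' + q') / d;
     ln lambda * t])).
- exact/heis_ext_arithmetic/area_form_int/rpred1.
- check_linear.
- rewrite /d; check_inverse.
- rewrite /d; check_heis_bracket FD.
Qed.

End HeisenbergAlgebras.

(** * The free nilpotent group of step 3 on two generators *)

Section FreeNilpotentLaw.
Context {R : realType}.
Local Notation rV := 'rV[R]_5.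

Definition coef5 (x : rV) (k : nat) : R := x 0 (inord k).

Lemma coef5_ord (x : rV) (i : 'I_5) : x 0 i = coef5 x i.
Proof. by rewrite /coef5 inord_val. Qed.

Lemma coef5_mxl (x : rV) rows k : (k < 5)%N ->
  coef5 (x *m mxl 5 5 rows) k =
  coef5 x 0 * entry rows 0 k + coef5 x 1 * entry rows 1 k +
  coef5 x 2 * entry rows 2 k + coef5 x 3 * entry rows 3 k +
  coef5 x 4 * entry rows 4 k.
Proof.
move=> k5; rewrite [LHS]mxE !big_ord_recl big_ord0 addr0 !mxE !coef5_ord.
by rewrite inordK//= !addrA.
Qed.

Lemma coef5D (x y : rV) k : coef5 (x + y) k = coef5 x k + coef5 y k.
Proof. by rewrite /coef5 mxE. Qed.

Lemma coef5Z a (x : rV) k : coef5 (a *: x) k = a * coef5 x k.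
Proof. by rewrite /coef5 mxE. Qed.

Lemma coef5N (x : rV) k : coef5 (- x) k = - coef5 x k.
Proof. by rewrite /coef5 mxE. Qed.

(* The free nilpotent group of step 3 on two generators, with coordinates      *)
(* (d, c, p), where d and p are in R^2 and c in R:                             *)
(*   c'' = c + c' + w(p, p') and d'' = d + d' - c p' + 2 c' p + w(p, p') p,    *)
(* where w is the area form; associativity is the identity                     *)
(* w(p, p') p'' + w(p', p'') p + w(p'', p) p' = 0.                             *)
Definition free_rows (c p q : R) : seq (seq R) :=
  [:: [:: 1]; [:: 0; 1]; [:: 2 * p; 2 * q; 1];
      [:: - c - p * q; - (q * q); - q; 1]; [:: p * p; p * q - c; p; 0; 1]].

Definition free_mx (x : rV) : 'M[R]_5 :=
  mxl 5 5 (free_rows (coef5 x 2) (coef5 x 3) (coef5 x 4)).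

Ltac check_entries :=
  apply/matrixP; case_ordinals;
  rewrite !mxE ?big_ord_recl ?big_ord0 ?mxE /entry /=; ring.

Fact free_mx0 : free_mx 0 = 1%:M.
Proof. by rewrite /free_mx /coef5 !mxE; check_entries. Qed.

Fact free_mxM x y : free_mx (x + y *m free_mx x) = free_mx y *m free_mx x.
Proof.
rewrite [LHS]/free_mx !coef5D !coef5_mxl// /entry /= /free_mx.
move: (coef5 x 2) (coef5 x 3) (coef5 x 4) => c p q.
move: (coef5 y 0) (coef5 y 1) (coef5 y 2) (coef5 y 3) (coef5 y 4) =>
  a b c' p' q'.
check_entries.
Qed.

Fact free_mxN x : free_mx x *m free_mx (- x) = 1%:M.
Proof.
rewrite /free_mx !coef5N.
move: (coef5 x 2) (coef5 x 3) (coef5 x 4) => c p q; check_entries.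
Qed.

Fact free_unit x : free_mx x \in unitmx.
Proof. by have [] := mulmx1_unit (free_mxN x). Qed.

Fact free_smooth k : Ck_mx k free_mx.
Proof.
have C0 (c : R) : Ck_on k setT (fun _ : rV => c) by exact: Ck_cst.
have Cx l : Ck_on k setT (fun x : rV => coef5 x l) by exact: Ck_coord.
case_ordinals; under eq_fun do rewrite mxE /entry /=; rewrite /=;
  by do ?[exact: C0 | exact: Cx | apply: CkN | apply: CkD | apply: CkM].
Qed.

Definition free_law : affine_law R 5 :=
  AffineLaw free_mx0 free_mxM free_unit free_smooth.

Lemma free_arithmetic : arithmetic free_law.
Proof.
have Z x : integral_mx x -> integral_mx (free_mx x).
  move=> Zx; have Zc l : coef5 x l \is a Num.int by exact: Zx.
  case_ordinals; rewrite mxE /entry /=;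
    by do ?[exact: Zc | exact: rpred0 | exact: rpred1 | exact: natr_int
           | rewrite rpredN | apply: rpredB | apply: rpredM].
split=> [x Zx|x Zx|s i l j ij] /=; first exact: Z.
  have -> : invmx (free_mx x) = free_mx (- x).
    by rewrite -[LHS]mulmx1 -(free_mxN x) mulKmx// free_unit.
  exact/Z/integralN.
have cE k : (k < 5)%N -> coef5 (s *: delta_mx 0 i) k = s * (k == i)%:R.
  by move=> k5; rewrite /coef5 !mxE eqxx -val_eqE /= inordK.
rewrite mxE !cE//.
by case: i l j ij {cE} => [[|[|[|[|[|?]]]]] // ?] [[|[|[|[|[|?]]]]] // ?]
  [[|[|[|[|[|?]]]]] // ?] //= _; rewrite /entry /=; ring.
Qed.

(** The entries of [free_mx] are polynomials of degree at most 2 along each line through the origin,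
    so their differential is read off the linear term. *)
Lemma derive_quadratic (f : rV -> R) u l q :
  (forall h : R, f (h *: u) = f 0 + h * l + h * h * q) -> 'D_u f 0 = l.
Proof.
move=> fE; apply/cvg_lim => //.
have lc : (fun h : R => l + h * q) @ 0^' --> l.
  rewrite -[X in _ --> X]addr0 -[X in _ + X](mul0r q).
  apply: cvgD; first exact: cvg_cst.
  apply: cvgM; last exact: cvg_cst.
  exact: (cvg_within_filter _ (@cvg_id _ (nbhs (0 : R)))).
apply: cvg_trans lc; apply: near_eq_cvg; near=> h => /=.
have h0 : h != 0 by near: h; exact: nbhs_dnbhs_neq.
rewrite addr0 fE; move: (f 0) => y; rewrite /GRing.scale /=; field.
Unshelve. all: by end_near. Qed.

Definition free_drows (c p q : R) : seq (seq R) :=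
  [:: [::]; [::]; [:: 2 * p; 2 * q]; [:: - c; 0; - q]; [:: 0; - c; p]].

Lemma free_dlmat u :
  dlmat free_law u = mxl 5 5 (free_drows (coef5 u 2) (coef5 u 3) (coef5 u 4)).
Proof.
pose Q : 'M[R]_5 := let p := coef5 u 3 in let q := coef5 u 4 in
  mxl 5 5 [:: [::]; [::]; [::]; [:: - (p * q); - (q * q)]; [:: p * p; p * q]].
pose D : 'M[R]_5 := mxl 5 5 (free_drows (coef5 u 2) (coef5 u 3) (coef5 u 4)).
have E (h : R) : free_mx (h *: u) = 1%:M + h *: D + (h * h) *: Q.
  rewrite /free_mx !coef5Z /D /Q.
  move: (coef5 u 2) (coef5 u 3) (coef5 u 4) => c p q; check_entries.
apply/matrixP => i j; rewrite mxE.
apply: (@derive_quadratic _ _ _ (Q i j)) => h /=.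
by rewrite free_mx0 E !mxE.
Qed.

Lemma free_bracketE x y k : (k < 5)%N ->
  coef5 (affine_bracket free_law x y) k =
  nth 0 [:: 3 * (coef5 y 2 * coef5 x 3 - coef5 x 2 * coef5 y 3);
            3 * (coef5 y 2 * coef5 x 4 - coef5 x 2 * coef5 y 4);
            2 * (coef5 x 3 * coef5 y 4 - coef5 x 4 * coef5 y 3)] k.
Proof.
move=> k5; rewrite /affine_bracket !free_dlmat coef5D coef5N !coef5_mxl//.
by case: k k5 => [|[|[|[|[|]]]]] // _; rewrite /entry /=; ring.
Qed.

End FreeNilpotentLaw.

(** * The algebra g_9 *)

Section FreeByLine.
Context {R : realType}.
Variable tau : R.
Hypothesis tauE : tau = 2 * pi.

Ltac check_entries :=
  apply/matrixP; case_ordinals;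
  rewrite !mxE ?big_ord_recl ?big_ord0 ?mxE /entry /=; ring.

Definition double_turn (t : R) : seq (seq R) :=
  [:: [:: 0; t; 0; 0; 0]; [:: - t; 0; 0; 0; 0]; [::];
      [:: 0; 0; 0; 0; t]; [:: 0; 0; 0; - t; 0]].

Definition shear : seq (seq R) := [:: [::]; [::]; [::]; [:: 0; 1]; [:: -1; 0]].

Lemma double_turn_square : mxl 5 5 (double_turn 1) *m mxl 5 5 (double_turn 1) =
  mxl 5 5 [:: [:: -1]; [:: 0; -1]; [::]; [:: 0; 0; 0; -1]; [:: 0; 0; 0; 0; -1]].
Proof. check_entries. Qed.

Lemma double_turn_flow : exists F : flow R 5,
  cubic_form (-1) F (mxl 5 5 (double_turn 1)) /\
  generator F (mxl 5 5 (double_turn tau)).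
Proof.
have -> : mxl 5 5 (double_turn tau) = tau *: mxl 5 5 (double_turn 1).
  by check_entries.
rewrite tauE; apply: rotation_flow; rewrite double_turn_square; check_entries.
Qed.

Lemma shear_square : mxl 5 5 shear *m mxl 5 5 shear = 0.
Proof. check_entries. Qed.

Lemma shear_flow : exists F : flow R 5,
  cubic_form 0 F (mxl 5 5 shear) /\ generator F (mxl 5 5 shear).
Proof.
apply: unipotent_flow shear_square.
by case_ordinals; rewrite mxE /entry /= ?rpredN ?rpred0 ?rpred1.
Qed.

Lemma double_turn_shear_comm :
  comm_mx (mxl 5 5 (double_turn 1)) (mxl 5 5 shear).
Proof. check_entries. Qed.

(** With f = sin and 1 - g = cos, the same rotation acts on d and p and preserves the area form w;
    [fg] is the relation cos^2 + sin^2 = 1. *)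
Lemma double_turn_equivariant F :
  cubic_form (-1) F (mxl 5 5 (double_turn 1)) -> equivariant (@free_law R) F.
Proof.
move=> cF x t; have [f [g [-> _ fg]]] := cF t.
rewrite double_turn_square.
have -> : 1%:M + f *: mxl 5 5 (double_turn 1) + g *: mxl 5 5
    [:: [:: -1]; [:: 0; -1]; [::]; [:: 0; 0; 0; -1]; [:: 0; 0; 0; 0; -1]] =
  mxl 5 5 [:: [:: 1 - g; f]; [:: - f; 1 - g]; [:: 0; 0; 1];
              [:: 0; 0; 0; 1 - g; f]; [:: 0; 0; 0; - f; 1 - g]].
  by check_entries.
rewrite /= /free_mx !coef5_mxl// /entry /=.
have {}fg : f * f = 2 * g - g * g by move: fg; rewrite !expr2 => ->; ring.
move: (coef5 x 0) (coef5 x 1) (coef5 x 2) (coef5 x 3) (coef5 x 4) => a b c p q.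
apply/matrixP; case_ordinals;
  rewrite !mxE ?big_ord_recl ?big_ord0 ?mxE /entry /=; ring: fg.
Qed.

(** The shear adds to the central part d a linear function of p, and p is additive under the
    product. *)
Lemma shear_equivariant F :
  cubic_form 0 F (mxl 5 5 shear) -> equivariant (@free_law R) F.
Proof.
move=> cF x t; have [f [g [-> _ _]]] := cF t.
rewrite shear_square scaler0 addr0.
have -> : 1%:M + f *: mxl 5 5 shear =
  mxl 5 5 [:: [:: 1]; [:: 0; 1]; [:: 0; 0; 1]; [:: 0; f; 0; 1]; [:: - f; 0; 0;
    0; 1]].
  by check_entries.
rewrite /= /free_mx !coef5_mxl// /entry /=.
move: (coef5 x 0) (coef5 x 1) (coef5 x 2) (coef5 x 3) (coef5 x 4) => a b c p q.
check_entries.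
Qed.

Lemma free_ext_bracketE (F : flow R 5) (eF : equivariant free_law F) f :
  generator F (mxl 5 5 f) -> forall (x y : 'rV[R]_(5 + 1)) k, (k < 5)%N ->
  coef (affine_bracket (extension eF) x y) k =
  nth 0 [:: 3 * (coef y 2 * coef x 3 - coef x 2 * coef y 3);
            3 * (coef y 2 * coef x 4 - coef x 2 * coef y 4);
            2 * (coef x 3 * coef y 4 - coef x 4 * coef y 3)] k +
  \sum_(l < 5) (coef x 5 * coef y l - coef y 5 * coef x l) * entry f l k.
Proof.
move=> FD x y k k5.
have -> : coef (affine_bracket (extension eF) x y) k =
    (affine_bracket (extension eF) x y) 0 (lshift 1 (inord k)).
  by rewrite coef_ord /= inordK.
have t5 (z : 'rV[R]_(5 + 1)) : rsubmx z 0 0 = coef z 5.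
  by rewrite mxE coef_ord.
have cE (z : 'rV[R]_(5 + 1)) (l : 'I_5) : lsubmx z 0 l = coef z l.
  by rewrite mxE coef_ord.
have c5 (z : 'rV[R]_(5 + 1)) l : (l < 5)%N -> coef5 (lsubmx z) l = coef z l.
  by move=> l5; rewrite /coef5 cE inordK.
have E (z : 'rV[R]_(5 + 1)) : (lsubmx z *m mxl 5 5 f) 0 (inord k) =
    \sum_(l < 5) coef z l * entry f l k.
  by rewrite mxE; apply: eq_bigr => l _; rewrite cE mxE inordK.
have lin (b c : R) (A B C : 'rV[R]_5) j :
    (A + (b *: B - c *: C)) 0 j = A 0 j + (b * B 0 j - c * C 0 j).
  by rewrite !mxE.
rewrite (extension_bracket _ FD) row_mxEl lin !t5 !E.
rewrite -[affine_bracket _ _ _ _ _]/(coef5 _ k) free_bracketE// !c5//.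
rewrite !mulr_sumr -!sumrB; congr (_ + _).
by apply: eq_bigr => l _; ring.
Qed.

Lemma free_ext_bracket5 (F : flow R 5) (eF : equivariant free_law F) f :
  generator F (mxl 5 5 f) -> forall (x y : 'rV[R]_(5 + 1)),
  coef (affine_bracket (extension eF) x y) 5 = 0.
Proof.
move=> FD x y.
have -> : coef (affine_bracket (extension eF) x y) 5 =
    (affine_bracket (extension eF) x y) 0 (rshift 5 0).
  by rewrite coef_ord.
by rewrite (extension_bracket _ FD) row_mxEr mxE.
Qed.

(** Besides a rotation, ad e_6 has a nilpotent part sending e_5 to e_3, which does not commute with
    the rotation. Adding a multiple of x5 to the coordinate of x2 replaces it by half of a quarter
    turn from p to d, which does commute; the flow is then the product of a rotation and a unipotent
    flow. *)
Lemma g9_lattice : simply_connected_group_has_lattice (g9 (R := R)).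
Proof.
have [T [cT TD]] := double_turn_flow; have [U [cU UD]] := shear_flow.
have TU s t : flow_mx T s *m flow_mx U t = flow_mx U t *m flow_mx T s.
  apply/(cubic_form_comm _ cU)/comm_mx_sym/(cubic_form_comm _ cT).
  exact/comm_mx_sym/double_turn_shear_comm.
pose eF := product_equivariant TU (double_turn_equivariant cT)
  (shear_equivariant cU).
have FD : generator (product_flow TU) (mxl 5 5
    [:: [:: 0; tau; 0; 0; 0]; [:: - tau; 0; 0; 0; 0]; [::];
        [:: 0; 1; 0; 0; tau]; [:: -1; 0; 0; - tau; 0]]).
  by have := product_generator TU TD UD; congr generator; check_entries.
have tau_gt0 : 0 < tau by rewrite tauE mulr_gt0// pi_gt0.
have [s s0 tau_s] : exists2 s, s != 0 & tau = (3 * (s * s))^-1.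
  exists (Num.sqrt (3 * tau)^-1);
    first by rewrite gt_eqF// sqrtr_gt0 invr_gt0 mulr_gt0.
  rewrite -expr2 sqr_sqrtr; last by rewrite invr_ge0 mulr_ge0// ltW.
  by rewrite invfM invrK mulrA mulVf// mul1r.
(* The scale s matches the unit shear in the lattice coordinates with the      *)
(* coefficient of e^{56} in de^3.                                              *)
apply: (@row_app_has_lattice R (extension eF) _
  (fun x1 x2 x3 x4 x5 x6 => [:: - (6 * (s * s * s)) * x3;
     - (6 * (s * s * s)) * x2 + 3 * (s * s * s) * x5;
     - (2 * (s * s)) * x1; s * x4; s * x5; 3 * (s * s) * x6])
  (fun d1 d2 c p q t => [:: - c / (2 * (s * s));
    (3 * (s * s) * q - d2) / (6 * (s * s * s));
     - d1 / (6 * (s * s * s)); p / s; q / s; t / (3 * (s * s))])).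
- exact: (@extension_arithmetic R 5 _ _ eF (@free_arithmetic R)).
- check_linear.
- by move=> x; apply: coefP; split; rewrite coef_row_app//= !coef_row_app//=;
    field.
- rewrite tau_s in FD; move=> u v; apply: coefP; split; rewrite coef_row_app//=
    ?(free_ext_bracket5 _ FD) ?(free_ext_bracketE _ FD)//=
    ?big_ord_recl ?big_ord0 !coef_ce_bracket//=
    ?(eval_wedge, eval_form0, eval_formN, eval_formZ, eval_formD)
    ?coef_row_app//= /entry /=; by field.
Qed.

End FreeByLine.

(** * Conclusion and the countable family of values of alpha *)

Lemma lambda_of_inj (R : realType) (m n : nat) :
  (2 <= m)%N -> (2 <= n)%N -> lambda_of m = lambda_of n :> R -> m = n.
Proof.
move=> m2 n2 mn; apply/eqP; rewrite -(eqr_nat R).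
by rewrite -!lambda_trace// mn.
Qed.

Theorem proposition2p10 (R : realType) :
  (simply_connected_group_has_lattice (g1 (R := R)) /\
   simply_connected_group_has_lattice (g3 (R := R)) /\
   simply_connected_group_has_lattice (g4 (R := R)) /\
   simply_connected_group_has_lattice (g5 (R := R)) /\
   simply_connected_group_has_lattice (g6 (R := R)) /\
   simply_connected_group_has_lattice (g7 (R := R)) /\
   simply_connected_group_has_lattice (g8 (R := R)) /\
   simply_connected_group_has_lattice (g9 (R := R))) /\
  (exists A : set R,
    [/\ A `<=` [set alpha : R | 0 <= alpha],
        (A #= [set: nat])%card,
        A 0 &
        forall alpha, A alpha ->
          simply_connected_group_has_lattice (g2 alpha)]).
Proof.
have l3 : 1 < lambda_of 3 :> R by exact: lambda_gt1.
have tr N : (2 <= N)%N -> (lambda_of N : R) + (lambda_of N)^-1 \is a Num.int.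
  by move=> N2; rewrite lambda_trace// natr_int.
have t3 := tr 3%N isT.
have tauE : 2 * pi = 2 * pi :> R by [].
split.
  split; first exact (g1_lattice l3 t3).
  split; first exact (g3_lattice l3 tauE t3).
  split; first exact (g4_lattice tauE).
  split; first exact (g5_lattice l3 t3).
  split; first exact (g6_lattice tauE).
  split; first exact (g7_lattice tauE).
  split; first exact (g8_lattice l3 tauE t3).
  exact (g9_lattice tauE).
(* The index is shifted so that n = 0 gives trace 2, lambda = 1 and alpha = 0. *)
pose alpha (n : nat) : R := ln (lambda_of n.+2) / (2 * pi).
have tau0 : 0 < 2 * pi :> R by rewrite mulr_gt0// pi_gt0.
have l2 : lambda_of 2 = 1 :> R
  by rewrite /lambda_of expr2 -natrM subrr sqrtr0 addr0 divff.
have l_gt0 n : 0 < lambda_of n.+2 :> R.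
  by case: n => [|n]; [rewrite l2 | exact: lt_trans (lambda_gt1 _)].
exists (range alpha); split.
- move=> _ [[|n] _ <-]; rewrite /= /alpha; first by rewrite l2 ln1 mul0r.
  by rewrite divr_ge0// ?ltW// ln_gt0// lambda_gt1.
- apply: inj_card_eq => m n _ _ /(mulIf (invr_neq0 (lt0r_neq0 tau0))).
  move=> /(ln_inj _ _); rewrite !posrE !l_gt0 => /(_ isT isT).
  by move=> /lambda_of_inj => /(_ isT isT) [].
- by exists 0%N => //; rewrite /alpha l2 ln1 mul0r.
(* The value alpha = 0 is treated apart, the hyperbolic flow requiring lambda > 1. *)
move=> _ [[|n] _ <-]; rewrite /alpha.
  by rewrite l2 ln1 mul0r; exact (g2_0_lattice tauE).
by apply: g2_lattice; [exact: lambda_gt1 | | exact: tr].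
Qed.
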